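(* Let $\mathcal{N}$ be an open subset of a Fréchet space $E$, let $L\in C^{\infty}(\mathcal{N}\times E,\mathbb{R})$ be a Lagrangian, and let $I\subset\mathbb{R}$ be an open interval. A curve $c\in C^{\infty}(I,\mathcal{N})$ is critical for $L$ if and only if for every $y\in E$ the function $t\mapsto D_2L(c(t),c'(t))(y)$ is $C^{1}$ on $I$ and $$\frac{d}{dt}\Bigl[D_2L\bigl(c(t),c'(t)\bigr)(y)\Bigr]=D_1L\bigl(c(t),c'(t)\bigr)(y),\qquad t\in I,\ y\in E.$$
   Context: Smoothness is in the convenient sense: a map between open subsets of Fréchet spaces is smooth if it sends smooth curves to smooth curves (for Fréchet spaces this coincides with Michal–Bastiani smoothness). $T\mathcal{N}=\mathcal{N}\times E$, and a Lagrangian is a smooth function $L\colon\mathcal{N}\times E\to\mathbb{R}$. $D_1L(g,k),D_2L(g,k)\in E'$ (continuous dual) denote the partial differentials of $L$ in the first and second arguments. A variation with compact support of $c\in C^\infty(I,\mathcal{N})$ is a smooth map $c_\bullet\colon\mathbb{R}\times I\to\mathcal{N}$, $(s,t)\mapsto c_s(t)$, with $c_0=c$ and such that there is a compact $K\subset I$ with $c_s(t)=c(t)$ for all $s$ and all $t\notin K$. The curve $c$ is critical for $L$ if for every variation with compact support $c_\bullet$ of $c$, and some (equivalently, any) relatively compact open $J\subset I$ containing the corresponding compact set $K$, $$\frac{d}{ds}\Big|_{s=0}\int_J L\bigl(c_s(t),c_s'(t)\bigr)\,dt=0,$$ where $c_s'=\partial_t c_s$. *)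

(* Defs.v *)
(* Smooth maps between open subsets of Frechet spaces, in the convenient sense,
   and the critical curves of a Lagrangian.

   A map defined on an open subset is represented by a total function together
   with that subset; everything below is local, hence independent of the values
   taken outside. *)
From HB Require Import structures.
From mathcomp Require Import all_boot all_order all_algebra.
From mathcomp Require Import all_classical all_reals all_analysis.

Set Implicit Arguments.
Unset Strict Implicit.
Unset Printing Implicit Defensive.

Import Order.TTheory GRing.Theory Num.Theory.
Import numFieldNormedType.Exports.

Local Open Scope ring_scope.
Local Open Scope classical_set_scope.

Section Frechet.
Context {R : realType} (E : tvsType R).

(* [p 0 = 0] and [0 <= p x] follow. *)
Definition seminorm (p : E -> R) : Prop :=
  (forall x y, p (x + y) <= p x + p y) /\
  (forall a x, p (a *: x) = `|a| * p x).

Definition generating_seminorms (p : nat -> E -> R) : Prop :=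
  (forall n, seminorm (p n)) /\
  forall U : set E, nbhs (0 : E) U <->
    exists n, exists2 e : R, 0 < e &
      [set x | forall i, (i <= n)%N -> p i x < e] `<=` U.

(* The uniform structure carried by a [tvsType] is only required to induce the
   topology, it need not be translation-invariant; so Cauchy sequences are
   expressed with differences and not with [entourage]. *)
Definition tvs_cauchy (u : nat -> E) : Prop :=
  forall U : set E, nbhs (0 : E) U ->
    exists N, forall i j, (N <= i)%N -> (N <= j)%N -> U (u i - u j).

(* Such a space is metrizable, so completeness can be tested on sequences. *)
Definition frechet_space : Prop :=
  [/\ hausdorff_space E,
      exists p : nat -> E -> R, generating_seminorms p &
      forall u : nat -> E, tvs_cauchy u -> exists l : E, u @ \oo --> l].

End Frechet.

Section Derivative.
Context {R : realType}.

Definition diff_quotient {E F : tvsType R} (f : E -> F) (a v : E) : R -> F :=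
  fun h => h^-1 *: ((f \o shift a) (h *: v) - f a).

(* These are [derivable] and [derive] of the library, which are restricted to
   normed modules; a [tvsType] is not a pointed type, so [cvg] and [lim] are not
   available and the limit is taken with [xget], with default value [0]. *)
Definition tvs_derivable {E F : tvsType R} (f : E -> F) (a v : E) : Prop :=
  exists l : F, diff_quotient f a v @ 0^' --> l.

Definition tvs_derive {E F : tvsType R} (f : E -> F) (a v : E) : F :=
  xget 0 [set l : F | diff_quotient f a v @ 0^' --> l].

Definition curve_derive {E : tvsType R} (c : R^o -> E) : R^o -> E :=
  fun t => tvs_derive c t 1.

Definition smooth_curve {E : tvsType R} (I : set R^o) (c : R^o -> E) : Prop :=
  forall (n : nat) (t : R^o), I t -> tvs_derivable (iter n curve_derive c) t 1.

Definition smooth_map {E F : tvsType R} (U : set E) (V : set F) (f : E -> F)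
    : Prop :=
  (forall x, U x -> V (f x)) /\
  forall g : R^o -> E, smooth_curve setT g -> (forall t, U (g t)) ->
    smooth_curve setT (f \o g).

Definition C1_on (I : set R^o) (f : R^o -> R^o) : Prop :=
  (forall t, I t -> derivable f t 1) /\
  (forall t, I t -> {for t, continuous f^`()}).

End Derivative.

Section Lagrangian.
Context {R : realType} {E : tvsType R}.

(* The partial differentials, as functions of the direction [y]; they are
   continuous linear forms when [L] is smooth. *)
Definition D1 (L : E * E -> R^o) (g k y : E) : R^o :=
  tvs_derive (fun x : E => L (x, k)) g y.

Definition D2 (L : E * E -> R^o) (g k y : E) : R^o :=
  tvs_derive (fun x : E => L (g, x)) k y.

Definition compact_variation (N : set E) (I : set R^o) (c : R^o -> E)
    (cs : R^o * R^o -> E) (K : set R^o) : Prop :=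
  [/\ smooth_map (setT `*` I) N cs,
      forall t, I t -> cs (0, t) = c t,
      compact K, K `<=` I &
      forall s t, I t -> ~ K t -> cs (s, t) = c t].

Definition lagrangian_action (L : E * E -> R^o) (J : set R^o) (c : R^o -> E) : R^o :=
  \int[@lebesgue_measure R]_(t in J) L (c t, curve_derive c t).

(* [closure J `<=` I] with [closure J] compact: [J] is relatively compact in
   the space [I]. *)
Definition critical (N : set E) (I : set R^o) (L : E * E -> R^o)
    (c : R^o -> E) : Prop :=
  forall (cs : R^o * R^o -> E) (K : set R^o), compact_variation N I c cs K ->
    exists J : set R^o,
      [/\ open J, compact (closure J), closure J `<=` I, K `<=` J &
          is_derive (0 : R^o) 1 (fun s => lagrangian_action L J (fun t => cs (s, t))) 0].

End Lagrangian.

(* Main.v *)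
(* A map that is smooth along curves is tame enough for classical calculus: if some
   n-th directional derivative were unbounded near a point, a smooth curve through
   rapidly converging points would be mapped to a curve with an unbounded n-th
   derivative. The mean value inequality for seminorms turns these local bounds into
   uniform Taylor estimates. Hence directional derivatives are jointly continuous and
   linear, and mixed second derivatives exist and are symmetric.

   Applied to [cs] and to [L], this gives the first variation of the action as the
   integral of [D1 L (c, c') w + D2 L (c, c') w'] with [w] the derivative of [cs] in [s]
   at [s = 0]. The Euler-Lagrange equation makes the integrand the derivative of
   [D2 L (c, c') w], which vanishes outside the support. Conversely
   [t |-> D2 L (c, c') y] is C1 whether or not [c] is critical, since its derivative is
   a mixed second derivative of [(s, t) |-> L (c t, c' t + s y)]; the variations
   [c + s chi(s) phi(t) y], with [chi] and [phi] bumps, and an integration by parts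
   then give the equation. *)
Require Import Defs.
From mathcomp Require Import all_boot all_order all_algebra.
From mathcomp Require Import all_classical all_reals all_analysis.
From mathcomp Require Import ring lra measurable_realfun.
Import Order.TTheory GRing.Theory Num.Theory.
Import numFieldNormedType.Exports.
Local Open Scope ring_scope.
Local Open Scope classical_set_scope.

Set Implicit Arguments.
Unset Strict Implicit.
Unset Printing Implicit Defensive.

(** * Calculus of curves *)

(** Smoothness along curves directly yields only iterated derivatives along a single line, and not
    even continuity. Three devices make up for this. Limits are stated with base point, direction
    and step varying together: the first variation moves [L] along a curve that is not affine, and
    it has to be uniform in time; the same strict form gives additivity of the derivative. Mixed
    second derivatives are obtained by polarization from pure ones along diagonals, so that symmetry
    is algebra and Taylor estimates along lines suffice. Derivatives of curves are handled through a
    continuous factor instead of a quotient, which reduces every rule to a limit of sums, multiples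
    and composites. In the unboundedness argument the weights [2 ^- (m * m)] are fixed first: they
    absorb every factor [2 ^+ (m * k)] that differentiating a bump around [2 ^- m] produces. The bad
    points are chosen afterwards, with derivatives large enough to outweigh these weights. *)

Section TvsLimits.
Context {R : realType} {T : Type} {F : set_system T} {FF : Filter F}.
Context {E : tvsType R}.

Lemma tvs_cvgD (f g : T -> E) (a b : E) :
  f @ F --> a -> g @ F --> b -> (fun x => f x + g x) @ F --> a + b.
Proof. by move=> fa gb; exact: (cvg_comp2 fa gb (@add_continuous E (a, b))). Qed.

Lemma tvs_cvgZ (k : T -> R^o) (f : T -> E) (r : R^o) (a : E) :
  k @ F --> r -> f @ F --> a -> (fun x => k x *: f x) @ F --> r *: a.
Proof. by move=> kr fa; exact: (cvg_comp2 kr fa (@scale_continuous R E (r, a))). Qed.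

Lemma tvs_cvgN (f : T -> E) (a : E) : f @ F --> a -> (fun x => - f x) @ F --> - a.
Proof.
move=> fa; have -> : (fun x => - f x) = (fun x => (-1 : R^o) *: f x).
  by apply/funext => x; rewrite scaleN1r.
by rewrite -[- a]scaleN1r; exact: (@tvs_cvgZ (cst (-1)) f (-1) a (cvg_cst _) fa).
Qed.

Lemma tvs_cvgB (f g : T -> E) (a b : E) :
  f @ F --> a -> g @ F --> b -> (fun x => f x - g x) @ F --> a - b.
Proof. by move=> fa gb; apply: tvs_cvgD => //; exact: tvs_cvgN. Qed.

End TvsLimits.

Section CurveDerivative.
Context {R : realType} {E : tvsType R}.
Implicit Types (g : R^o -> E) (t : R^o) (l : E).

Definition is_cderive g t l : Prop := diff_quotient g t 1 @ 0^' --> l.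

(** Caratheodory's form of the derivative: the difference quotient, completed by [l] at [t], is
    continuous there. No division remains; in a composite, zeros of the inner increment need no
    separate case. *)
Lemma is_cderiveP g t l : is_cderive g t l <->
  exists k : R^o -> E,
    [/\ k @ t --> l, k t = l & forall x, g x = g t + (x - t) *: k x].
Proof.
have q h : diff_quotient g t 1 h = h^-1 *: (g (h + t) - g t).
  by rewrite /diff_quotient /= -[h *: 1]/(h * 1) mulr1.
split=> [gl|[k [kl kt gk]]]; last first.
  apply: cvg_trans (_ : (fun h : R^o => k (h + t)) @ 0^' --> l).
    apply: near_eq_cvg; near=> h.
    have h0 : h != 0 by near: h; exact: nbhs_dnbhs_neq.
    by rewrite q gk addrAC subrr add0r addrK scalerA mulVf // scale1r.
  apply: (@cvg_comp _ _ _ (fun h : R^o => h + t) k _ (nbhs t)) kl.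
  apply: cvg_trans (_ : (h + t) @[h --> (0 : R^o)] --> t).
    by apply: cvg_app; exact: cvg_within.
  by rewrite -[X in _ --> X]add0r; apply: tvs_cvgD; [exact: cvg_id|exact: cvg_cst].
exists (fun x => if x == t then l else (x - t)^-1 *: (g x - g t)); split.
- move=> U Ul; have := gl U Ul; rewrite /= !near_simpl.
  rewrite near_withinE => qU.
  have sub : (x - t) @[x --> t] --> (0 : R^o).
    by rewrite -(subrr t); apply: tvs_cvgB; [exact: cvg_id|exact: cvg_cst].
  have := sub _ qU; rewrite !near_simpl; apply: filterS => x /= qx.
  case: eqP => [_|/eqP xt]; first exact: nbhs_singleton.
  by have := qx; rewrite subr_eq0 /= => /(_ xt); rewrite q subrK.
- by rewrite eqxx.
- move=> x; case: eqP => [->|/eqP xt]; first by rewrite subrr scale0r addr0.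
  by rewrite scalerA divff ?subr_eq0 // scale1r addrC subrK.
Unshelve. all: by end_near. Qed.

Lemma is_cderive_cvg g t l : is_cderive g t l -> g @ t --> g t.
Proof.
move=> /is_cderiveP[k [kl kt gk]].
have -> : g = (fun x => g t + (x - t) *: k x) by apply/funext => x; exact: gk.
rewrite [X in _ --> X](_ : _ = g t + (t - t) *: l); last first.
  by rewrite subrr !scale0r.
apply: tvs_cvgD; first exact: cvg_cst.
by apply: tvs_cvgZ => //; apply: tvs_cvgB; [exact: cvg_id|exact: cvg_cst].
Qed.

Lemma is_cderive_near g f t l :
  (\forall x \near t, g x = f x) -> is_cderive g t l -> is_cderive f t l.
Proof.
move=> gf /is_cderiveP[k [kl kt gk]]; apply/is_cderiveP.
exists (fun x => if x == t then l else (x - t)^-1 *: (f x - f t)); split.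
- apply: cvg_trans kl; apply: near_eq_cvg.
  have gft := nbhs_singleton gf.
  near=> x; case: eqP => [->//|/eqP xt].
  rewrite -(near gf x) // -gft gk addrAC subrr add0r scalerA mulVf ?scale1r //.
  by rewrite subr_eq0.
- by rewrite eqxx.
- move=> x; case: eqP => [->|/eqP xt]; first by rewrite subrr scale0r addr0.
  by rewrite scalerA divff ?subr_eq0 // scale1r addrC subrK.
Unshelve. all: by end_near. Qed.

Lemma is_cderive_cst (a : E) t : is_cderive (cst a) t 0.
Proof.
apply/is_cderiveP; exists (cst 0); split => //; first exact: cvg_cst.
by move=> x /=; rewrite scaler0 addr0.
Qed.

Lemma is_cderiveD g f t l m :
  is_cderive g t l -> is_cderive f t m -> is_cderive (fun x => g x + f x) t (l + m).
Proof.
move=> /is_cderiveP[k [kl kt gk]] /is_cderiveP[j [jl jt fj]].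
apply/is_cderiveP; exists (fun x => k x + j x); split; first exact: tvs_cvgD.
  by rewrite kt jt.
by move=> x; rewrite gk fj scalerDr addrACA.
Qed.

End CurveDerivative.

Section CurveCalculus.
Context {R : realType} {E : tvsType R}.
Implicit Types (g : R^o -> E) (r : R^o -> R^o) (t : R^o) (l : E).

Lemma is_cderiveZ r dr g t l :
  is_cderive r t dr -> is_cderive g t l ->
  is_cderive (fun x => r x *: g x) t (dr *: g t + r t *: l).
Proof.
move=> rdr gl; have gt := is_cderive_cvg gl.
have /is_cderiveP[k [kl kt gk]] := gl.
have /is_cderiveP[j [jl jt rj]] := rdr.
apply/is_cderiveP; exists (fun x => j x *: g x + r t *: k x); split.
- apply: tvs_cvgD; first exact: tvs_cvgZ.
  exact: (@tvs_cvgZ _ _ _ _ _ (cst (r t)) k (r t) l (cvg_cst _) kl).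
- by rewrite jt kt.
- move=> x; have e : r t *: g x = r t *: g t + (x - t) *: (r t *: k x).
    by rewrite {1}gk scalerDr !scalerA mulrC.
  rewrite {1}rj scalerDl e -addrA scalerDr.
  rewrite -[((x - t) *: j x) *: g x]/(((x - t) * j x) *: g x) -scalerA.
  by rewrite [X in _ + X = _]addrC.
Qed.

Lemma is_cderive_comp r dr g t l :
  is_cderive r t dr -> is_cderive g (r t) l -> is_cderive (g \o r) t (dr *: l).
Proof.
move=> rdr gl; have rt := is_cderive_cvg rdr.
have /is_cderiveP[k [kl kt gk]] := gl.
have /is_cderiveP[j [jl jt rj]] := rdr.
apply/is_cderiveP; exists (fun x => j x *: k (r x)); split.
- apply: tvs_cvgZ => //; exact: cvg_comp rt kl.
- by rewrite jt kt.
- move=> x /=; rewrite {1}gk; congr (_ + _); rewrite scalerA.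
  by rewrite {1}rj [r t + _]addrC addrK.
Qed.

Lemma is_cderive_pair {G : tvsType R} g (f : R^o -> G) t l (m : G) :
  is_cderive g t l -> is_cderive f t m -> is_cderive (fun x => (g x, f x)) t (l, m).
Proof.
move=> /is_cderiveP[k [kl kt gk]] /is_cderiveP[j [jl jt fj]].
apply/is_cderiveP; exists (fun x => (k x, j x)); split; first exact: cvg_pair.
  by rewrite kt jt.
by move=> x; rewrite {1}gk {1}fj.
Qed.

Lemma is_cderive_id t : is_cderive (id : R^o -> R^o) t 1.
Proof.
apply/is_cderiveP; exists (cst 1); split => //; first exact: cvg_cst.
by move=> x /=; rewrite -[_ *: _]/(_ * _) mulr1 addrC subrK.
Qed.

Lemma is_cderive_fst {G : tvsType R} (g : R^o -> E * G) t (l : E * G) :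
  is_cderive g t l -> is_cderive (fun x => (g x).1) t l.1.
Proof.
move=> /is_cderiveP[k [kl kt gk]].
apply/is_cderiveP; exists (fun x => (k x).1); split.
- exact: (cvg_comp _ _ kl cvg_fst).
- by rewrite kt.
- by move=> x; rewrite {1}gk.
Qed.

Lemma is_cderive_snd {G : tvsType R} (g : R^o -> G * E) t (l : G * E) :
  is_cderive g t l -> is_cderive (fun x => (g x).2) t l.2.
Proof.
move=> /is_cderiveP[k [kl kt gk]].
apply/is_cderiveP; exists (fun x => (k x).2); split.
- exact: (cvg_comp _ _ kl cvg_snd).
- by rewrite kt.
- by move=> x; rewrite {1}gk.
Qed.

End CurveCalculus.

Section SmoothCurves.
Context {R : realType} {E : tvsType R}.
Hypothesis hausE : hausdorff_space E.
Implicit Types (g : R^o -> E) (A : set R^o) (t : R^o) (l : E).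

Lemma is_cderive_unique g t l m : is_cderive g t l -> is_cderive g t m -> l = m.
Proof. by move=> gl gm; exact: (cvg_unique hausE gl gm). Qed.

Lemma is_cderiveE g t l : is_cderive g t l -> curve_derive g t = l.
Proof.
move=> gl; rewrite /curve_derive /tvs_derive; case: xgetP => [m _ gm|/(_ l)//].
exact: is_cderive_unique gl.
Qed.

Lemma is_cderive_curve_derive g t :
  tvs_derivable g t 1 -> is_cderive g t (curve_derive g t).
Proof. by move=> [l gl]; rewrite (is_cderiveE gl). Qed.

Lemma is_cderive_derivable g t l : is_cderive g t l -> tvs_derivable g t 1.
Proof. by exists l. Qed.

Lemma smooth_curveS A g : smooth_curve A g <->
  (forall t, A t -> tvs_derivable g t 1) /\ smooth_curve A (curve_derive g).
Proof.
split=> [gA|[g0 gA] [|n]]; last by move=> t At; rewrite iterSr; exact: gA.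
  by split=> [|n] t At; [exact: (gA 0%N)|rewrite -iterSr; exact: gA].
by move=> t At; exact: g0.
Qed.

Lemma smooth_curve_cderive A g t :
  smooth_curve A g -> A t -> is_cderive g t (curve_derive g t).
Proof. by move=> /smooth_curveS[+ _] At => /(_ t At); exact: is_cderive_curve_derive. Qed.

Lemma iter_curve_derive_near n f g t :
  (\forall x \near t, g x = f x) ->
  \forall x \near t, iter n curve_derive g x = iter n curve_derive f x.
Proof.
move=> gf; elim: n => //= n IH.
have := near_join IH; apply: filterS => x gfx.
rewrite /curve_derive /tvs_derive; congr xget; apply/seteqP; split=> l /=;
  apply: is_cderive_near => //; by apply: filterS gfx.
Qed.

(* The closure properties of smooth curves are proved by induction on [n]. *)
Fixpoint Cn (n : nat) A g : Prop :=
  if n is n'.+1 then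
    exists2 g', (forall t, A t -> is_cderive g t (g' t)) & Cn n' A g'
  else True.

Lemma eq_Cn n A f g : open A -> (forall t, A t -> g t = f t) -> Cn n A g -> Cn n A f.
Proof.
case: n => //= n oA gf [g' gg' g'n]; exists g' => // t At.
apply: is_cderive_near (gg' _ At).
by near=> x; apply: gf; near: x; exact: open_nbhs_nbhs.
Unshelve. all: by end_near. Qed.

Lemma CnW n A g : Cn n.+1 A g -> Cn n A g.
Proof.
elim: n g => //= n IH g [g' gg' g'n]; exists g' => //; exact: IH.
Qed.

(** [smooth_curve] iterates the selected derivative [curve_derive], whereas [Cn] accepts any
    derivative on [A]; uniqueness of limits in a Hausdorff space identifies the two. *)
Lemma smooth_curveP A g : open A -> smooth_curve A g <-> forall n, Cn n A g.
Proof.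
move=> oA; split=> [gA n|gA n].
  elim: n g gA => //= n IH g gA; exists (curve_derive g).
    by move=> t; exact: smooth_curve_cderive.
  by apply: IH; have [] := (smooth_curveS A g).1 gA.
(* Differentiability of the [n]-th derivative takes one order more. *)
have : Cn n.+1 A g by [].
elim: n g {gA} => [|n IH] g [g' gg' g'n] t At.
  by exists (g' t); exact: gg'.
rewrite iterSr; apply: IH => //; apply: (@eq_Cn n.+1 A _ g' oA _ g'n) => x Ax.
by apply/esym/is_cderiveE/gg'.
Qed.

Lemma sub_smooth_curve A B g : A `<=` B -> smooth_curve B g -> smooth_curve A g.
Proof. by move=> AB gB n t /AB; exact: gB. Qed.

End SmoothCurves.

Section CnCalculus.
Context {R : realType}.
Implicit Types (A B : set R^o) (r : R^o -> R^o).

Lemma Cn_cst {E : tvsType R} n A (a : E) : Cn n A (cst a).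
Proof.
elim: n a => //= n IH a; exists (cst 0) => // t _; exact: is_cderive_cst.
Qed.

Lemma CnD {E : tvsType R} n A (f g : R^o -> E) :
  Cn n A f -> Cn n A g -> Cn n A (fun x => f x + g x).
Proof.
elim: n f g => //= n IH f g [f' ff' f'n] [g' gg' g'n].
exists (fun x => f' x + g' x); last exact: IH.
by move=> t At; apply: is_cderiveD; [exact: ff'|exact: gg'].
Qed.

Lemma CnZ {E : tvsType R} n A r (g : R^o -> E) :
  Cn n A r -> Cn n A g -> Cn n A (fun x => r x *: g x).
Proof.
elim: n r g => // n IH r g rn gn.
have [/= r' rr' r'n] := rn; have [/= g' gg' g'n] := gn.
exists (fun x => r' x *: g x + r x *: g' x).
  by move=> t At; apply: is_cderiveZ; [exact: rr'|exact: gg'].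
by apply: CnD; apply: IH => //; exact: CnW.
Qed.

Lemma Cn_comp {E : tvsType R} n A B r (g : R^o -> E) :
  (forall t, A t -> B (r t)) -> Cn n A r -> Cn n B g -> Cn n A (g \o r).
Proof.
move=> AB; elim: n g => // n IH g rn [/= g' gg' g'n].
have [/= r' rr' r'n] := rn.
exists (fun x => r' x *: (g' \o r) x).
  by move=> t At; apply: is_cderive_comp; [exact: rr'|exact/gg'/AB].
by apply: CnZ => //; apply: IH => //; exact: CnW.
Qed.

Lemma Cn_pair {E G : tvsType R} n A (f : R^o -> E) (g : R^o -> G) :
  Cn n A f -> Cn n A g -> Cn n A (fun x => (f x, g x)).
Proof.
elim: n f g => //= n IH f g [f' ff' f'n] [g' gg' g'n].
exists (fun x => (f' x, g' x)); last exact: IH.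
by move=> t At; apply: is_cderive_pair; [exact: ff'|exact: gg'].
Qed.

Lemma Cn_fst {E G : tvsType R} n A (g : R^o -> E * G) :
  Cn n A g -> Cn n A (fun x => (g x).1).
Proof.
elim: n g => //= n IH g [g' gg' g'n]; exists (fun x => (g' x).1); last exact: IH.
by move=> t At; apply: is_cderive_fst; exact: gg'.
Qed.

Lemma Cn_snd {E G : tvsType R} n A (g : R^o -> E * G) :
  Cn n A g -> Cn n A (fun x => (g x).2).
Proof.
elim: n g => //= n IH g [g' gg' g'n]; exists (fun x => (g' x).2); last exact: IH.
by move=> t At; apply: is_cderive_snd; exact: gg'.
Qed.

Lemma Cn_id n A : Cn n A (id : R^o -> R^o).
Proof.
case: n => //= n; exists (cst 1); last exact: Cn_cst.
by move=> t _; exact: is_cderive_id.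
Qed.

End CnCalculus.

Section SmoothCalculus.
Context {R : realType}.
Implicit Types (A B : set R^o) (r : R^o -> R^o).

Lemma haus_real : hausdorff_space (R^o : tvsType R).
Proof. exact: norm_hausdorff. Qed.

Lemma haus_prod {E G : tvsType R} : hausdorff_space E -> hausdorff_space G ->
  hausdorff_space (E * G : tvsType R)%type.
Proof.
move=> hE hG [x y] [x' y'] xy.
have xx' : x = x'.
  apply: hE => U V Ux Vx'.
  have [] := xy (fst @^-1` U) (fst @^-1` V).
  - exact: (cvg_fst Ux).
  - exact: (cvg_fst Vx').
  - by move=> z [Uz Vz]; exists z.1.
have yy' : y = y'; last by rewrite xx' yy'.
apply: hG => U V Uy Vy'.
have [] := xy (snd @^-1` U) (snd @^-1` V).
- exact: (cvg_snd Uy).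
- exact: (cvg_snd Vy').
- by move=> z [Uz Vz]; exists z.2.
Qed.

Variables (E G : tvsType R).
Hypotheses (hE : hausdorff_space E) (hG : hausdorff_space G).

Lemma smooth_cst A (a : E) : smooth_curve A (cst a).
Proof.
apply: (@sub_smooth_curve _ _ A setT) => //.
by apply/(smooth_curveP hE _ openT) => n; exact: Cn_cst.
Qed.

Lemma smoothD A (f g : R^o -> E) : open A ->
  smooth_curve A f -> smooth_curve A g -> smooth_curve A (fun x => f x + g x).
Proof.
move=> oA /(smooth_curveP hE _ oA) fA /(smooth_curveP hE _ oA) gA.
by apply/(smooth_curveP hE _ oA) => n; exact: CnD.
Qed.

Lemma smoothZ A r (g : R^o -> E) : open A ->
  smooth_curve A r -> smooth_curve A g -> smooth_curve A (fun x => r x *: g x).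
Proof.
move=> oA /(smooth_curveP haus_real _ oA) rA /(smooth_curveP hE _ oA) gA.
by apply/(smooth_curveP hE _ oA) => n; exact: CnZ.
Qed.

Lemma smooth_comp A B r (g : R^o -> E) : open A -> open B ->
  (forall t, A t -> B (r t)) -> smooth_curve A r -> smooth_curve B g ->
  smooth_curve A (g \o r).
Proof.
move=> oA oB AB /(smooth_curveP haus_real _ oA) rA /(smooth_curveP hE _ oB) gB.
by apply/(smooth_curveP hE _ oA) => n; exact: (Cn_comp AB (rA n) (gB n)).
Qed.

Lemma smooth_pair A (f : R^o -> E) (g : R^o -> G) : open A ->
  smooth_curve A f -> smooth_curve A g -> smooth_curve A (fun x => (f x, g x)).
Proof.
move=> oA /(smooth_curveP hE _ oA) fA /(smooth_curveP hG _ oA) gA.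
by apply/(smooth_curveP (haus_prod hE hG) _ oA) => n; exact: Cn_pair.
Qed.

Lemma smooth_fst A (g : R^o -> E * G) : open A ->
  smooth_curve A g -> smooth_curve A (fun x => (g x).1).
Proof.
move=> oA /(smooth_curveP (haus_prod hE hG) _ oA) gA.
by apply/(smooth_curveP hE _ oA) => n; exact: Cn_fst.
Qed.

Lemma smooth_snd A (g : R^o -> E * G) : open A ->
  smooth_curve A g -> smooth_curve A (fun x => (g x).2).
Proof.
move=> oA /(smooth_curveP (haus_prod hE hG) _ oA) gA.
by apply/(smooth_curveP hG _ oA) => n; exact: Cn_snd.
Qed.

Lemma smooth_id A : smooth_curve A (id : R^o -> R^o).
Proof.
apply: (@sub_smooth_curve _ _ A setT) => //.
by apply/(smooth_curveP haus_real _ openT) => n; exact: Cn_id.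
Qed.

Lemma smooth_derive A (g : R^o -> E) : smooth_curve A g ->
  smooth_curve A (curve_derive g).
Proof. by move=> /smooth_curveS[]. Qed.

End SmoothCalculus.

(** * Flat functions and plateaus *)

Section RealDerivative.
Context {R : realType}.

Lemma is_cderive_is_derive (f : R^o -> R^o) (t l : R^o) :
  is_cderive f t l <-> is_derive (t : R^o) (1 : R^o) f l.
Proof.
split=> [fl|[fd <-]].
  have fd : derivable f t 1 by apply/cvg_ex; exists l.
  by split => //; apply: cvg_lim => //; exact: norm_hausdorff.
exact: fd.
Qed.

End RealDerivative.

Section FlatFunction.
Context {R : realType}.

(** For [k = 0] the classical flat function. The powers of [x^-1] make the family stable under
    differentiation up to linear combinations, so one induction proves all its members smooth. *)
Definition flat_exp (k : nat) (x : R) : R :=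
  if 0 < x then x^-1 ^+ k * expR (- x^-1) else 0.

Lemma flat_exp_ge0 k x : 0 <= flat_exp k x.
Proof.
by rewrite /flat_exp; case: ifP => // x0; rewrite mulr_ge0 ?expR_ge0 ?exprn_ge0 ?invr_ge0 ?ltW.
Qed.

(** The term of degree [k.+1] of the exponential series at [x^-1] already dominates. The bound gives
    continuity at [0]. *)
Lemma flat_exp_le k x : flat_exp k x <= k.+1`!%:R * `|x|.
Proof.
rewrite /flat_exp; case: ifP => [x0|_]; last by rewrite mulr_ge0.
have y0 : 0 < x^-1 by rewrite invr_gt0.
have := expR_ge1Dxn k (ltW y0); rewrite expRN (gtr0_norm x0) => h.
have {h} : x^-1 ^+ k.+1 <= k.+1`!%:R * expR x^-1.
  rewrite -ler_pdivrMl ?ltr0n ?fact_gt0 // mulrC.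
  by apply: le_trans h; rewrite lerDr.
rewrite -ler_pdivrMr ?expR_gt0 // exprS -mulrA => h.
by rewrite -ler_pdivrMr // mulrC.
Qed.

Lemma is_cderive_flat_exp k (t : R) :
  is_cderive (flat_exp k : R^o -> R^o) t (- k%:R * flat_exp k.+1 t + flat_exp k.+2 t).
Proof.
have [t0|t0|t0] := ltgtP t 0.
- have -> : - k%:R * flat_exp k.+1 t + flat_exp k.+2 t = 0.
    by rewrite /flat_exp ltNge (ltW t0) /= mulr0 addr0.
  apply: (@is_cderive_near _ _ (cst 0)); last exact: is_cderive_cst.
  near=> x; rewrite /flat_exp /= ltNge.
  by have -> : x <= 0 by near: x; exact: lt_le_nbhsl.
- apply: (@is_cderive_near _ _ (fun x => x^-1 ^+ k * expR (- x^-1))).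
    near=> x; rewrite /flat_exp.
    by have -> : 0 < x by near: x; exact: lt_nbhsr.
  have tn0 : t != 0 by rewrite gt_eqF.
  have dV : is_cderive (fun x : R^o => x^-1 : R^o) t (- t^-1 ^+ 2).
    apply/is_cderive_is_derive.
    have dV := @is_deriveV R id t 1 1 tn0 (is_derive_id _ _).
    by apply: (is_derive_eq dV); rewrite exprVn /GRing.scale /= mulr1.
  have dX : is_cderive (fun x : R^o => x^-1 ^+ k : R^o) t (- k%:R * t^-1 ^+ k.+1).
    elim: (k) => [|n IH].
      by rewrite oppr0 mul0r; under eq_fun do rewrite expr0; exact: is_cderive_cst.
    under eq_fun do rewrite exprS.
    have := is_cderiveZ dV IH; rewrite /GRing.scale /=; congr is_cderive.
    by rewrite -natr1 !exprS; ring.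
  have dE : is_cderive (fun x : R^o => expR (- x^-1) : R^o) t (t^-1 ^+ 2 * expR (- t^-1)).
    have dN : is_cderive (fun x : R^o => - x^-1 : R^o) t (t^-1 ^+ 2).
      have := is_cderiveZ (is_cderive_cst (-1 : R^o) t) dV.
      by rewrite scale0r add0r /GRing.scale /= mulN1r opprK; under eq_fun do rewrite mulN1r.
    have dE := (iffRL (is_cderive_is_derive _ _ _)) (is_derive_expR (- t^-1)).
    exact: (is_cderive_comp dN dE).
  have := is_cderiveZ dX dE; rewrite /GRing.scale /=; congr is_cderive.
  by rewrite /flat_exp t0 !exprS; ring.
- rewrite {1}t0 /flat_exp t0 ltxx mulr0 addr0 -/(flat_exp k).
  (* At [0] the continuous factor is explicit, since [flat_exp k x = x * flat_exp k.+1 x]. *)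
  apply/is_cderiveP; exists (flat_exp k.+1); split.
  - apply/cvgrPdist_lt => e e0; near=> x.
    rewrite sub0r normrN ger0_norm ?flat_exp_ge0 //.
    rewrite (le_lt_trans (flat_exp_le _ _)) // -ltr_pdivlMl ?ltr0n ?fact_gt0 //.
    rewrite -[x]subr0 distrC; near: x; apply: cvgr_dist_lt => //.
    by rewrite mulr_gt0 // invr_gt0 ltr0n fact_gt0.
  - by rewrite /flat_exp ltxx.
  - move=> x; rewrite /flat_exp ltxx add0r subr0 /GRing.scale /=.
    case: ifP => x0; last by rewrite mulr0.
    by rewrite exprS !mulrA divff ?mul1r ?gt_eqF.
Unshelve. all: try by end_near. Qed.

Lemma Cn_flat_exp n k : Cn n setT (flat_exp k : R^o -> R^o).
Proof.
elim: n k => //= n IH k.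
exists (fun t : R^o => - k%:R * flat_exp k.+1 t + flat_exp k.+2 t : R^o).
  by move=> t _; exact: is_cderive_flat_exp.
by apply: CnD => //; exact: (@CnZ _ _ n setT (cst (- k%:R)) _ (Cn_cst _ _ _) (IH _)).
Qed.

End FlatFunction.

Section Plateau.
Context {R : realType}.
Implicit Types x : R^o.

Lemma CnV n A (f : R^o -> R^o) : (forall t, A t -> f t != 0) ->
  Cn n A f -> Cn n A (fun x => (f x)^-1 : R^o).
Proof.
move=> f0; elim: n f f0 => // n IH f f0 fn; have [/= f' ff' f'n] := fn.
have fVn : Cn n A (fun x => (f x)^-1 : R^o) by apply: IH => //; exact: CnW.
exists (fun x => - 1 * f' x * ((f x)^-1 * (f x)^-1) : R^o); last first.
  apply: (@CnZ _ _ n A (fun x => - 1 * f' x) (fun x => (f x)^-1 * (f x)^-1)).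
    by apply: (@CnZ _ _ n A (cst (-1)) f') => //; exact: Cn_cst.
  exact: CnZ.
move=> t At; have f't := (iffLR (is_cderive_is_derive _ _ _)) (ff' t At).
apply/is_cderive_is_derive; apply: (is_derive_eq (is_deriveV (f0 _ At) f't)).
by rewrite /GRing.scale /= -exprVn expr2 mulN1r !mulNr mulrC.
Qed.

Definition step x : R^o := flat_exp 0 x / (flat_exp 0 x + flat_exp 0 (1 - x)).

Lemma flat_exp_gt0 k x : 0 < x -> 0 < flat_exp k x.
Proof. by move=> x0; rewrite /flat_exp x0 mulr_gt0 ?expR_gt0 ?exprn_gt0 ?invr_gt0. Qed.

Lemma step_den_gt0 x : 0 < flat_exp 0 x + flat_exp 0 (1 - x).
Proof.
have [x0|x0] := ltP 0 x.
  by rewrite ltr_pwDl ?flat_exp_ge0 // flat_exp_gt0.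
by rewrite ltr_wpDl ?flat_exp_ge0 // flat_exp_gt0 // subr_gt0 (le_lt_trans x0).
Qed.

Lemma step_ge0 x : 0 <= step x.
Proof. by rewrite divr_ge0 ?flat_exp_ge0 // ltW ?step_den_gt0. Qed.

Lemma step_le1 x : step x <= 1.
Proof. by rewrite ler_pdivrMr ?step_den_gt0 // mul1r lerDl flat_exp_ge0. Qed.

Lemma step_eq0 x : x <= 0 -> step x = 0.
Proof. by move=> x0; rewrite /step {1}/flat_exp ltNge x0 /= mul0r. Qed.

Lemma step_eq1 x : 1 <= x -> step x = 1.
Proof.
move=> x1; rewrite /step [flat_exp 0 (1 - x)]/flat_exp subr_gt0 ltNge x1 /= addr0.
by rewrite divff // gt_eqF // flat_exp_gt0 // (lt_le_trans _ x1).
Qed.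

Lemma Cn_affine n A (a b : R) : Cn n A (fun x => a + b * x : R^o).
Proof.
by apply: CnD; [exact: Cn_cst|apply: (@CnZ _ _ _ _ (cst b)); [exact: Cn_cst|exact: Cn_id]].
Qed.

Lemma Cn_step n : Cn n setT step.
Proof.
apply: (@CnZ _ R^o _ _ (flat_exp 0)); first exact: Cn_flat_exp.
apply: CnV => [t _|]; first by rewrite gt_eqF ?step_den_gt0.
apply: CnD; first exact: Cn_flat_exp.
have := Cn_comp (fun _ _ => I) (Cn_affine n setT 1 (-1)) (Cn_flat_exp n 0).
by congr Cn; apply/funext => x /=; rewrite mulN1r.
Qed.

Definition plateau x : R^o := step (2 + 2 * x) * step (2 - 2 * x).

Lemma plateau_ge0 x : 0 <= plateau x.
Proof. by rewrite mulr_ge0 ?step_ge0. Qed.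

Lemma plateau_le1 x : plateau x <= 1.
Proof. by rewrite mulr_ile1 ?step_ge0 ?step_le1. Qed.

Lemma plateau_eq1 x : `|x| <= 2^-1 -> plateau x = 1.
Proof.
by rewrite ler_norml => /andP[x1 x2]; rewrite /plateau !step_eq1 ?mulr1 //; lra.
Qed.

Lemma plateau_eq0 x : 1 <= `|x| -> plateau x = 0.
Proof.
rewrite /plateau ler_normr => /orP[|] x1.
  by rewrite [step (2 - _)]step_eq0 ?mulr0 //; lra.
by rewrite step_eq0 ?mul0r //; lra.
Qed.

Lemma smooth_plateau A : smooth_curve A plateau.
Proof.
apply: (@sub_smooth_curve _ _ A setT) => //.
apply/(smooth_curveP (@haus_real R) _ openT) => n.
apply: (@CnZ _ R^o).
  exact: (Cn_comp (fun _ _ => I) (Cn_affine n setT 2 2) (Cn_step n)).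
have := Cn_comp (fun _ _ => I) (Cn_affine n setT 2 (-2)) (Cn_step n).
by congr Cn; apply/funext => x /=; rewrite mulNr.
Qed.

(** No sign or normalization is imposed, so that derivatives of bumps are bumps and [x * plateau x]
    is one. *)
Definition is_bump (h : R^o -> R^o) :=
  smooth_curve setT h /\ forall x, 1 < `|x| -> h x = 0.

Lemma bump_derive h : is_bump h -> is_bump (curve_derive h).
Proof.
move=> [hs h0]; split; first exact: smooth_derive.
move=> x x1; apply: is_cderiveE; first exact: haus_real.
apply: (@is_cderive_near _ _ (cst 0)); last exact: is_cderive_cst.
near=> y; rewrite h0 //; near: y.
have := @norm_continuous _ R^o x; move=> /(_ [set z | 1 < z]); apply.
exact: lt_nbhsr.
Unshelve. all: by end_near. Qed.

Lemma smooth_continuous {E : tvsType R} (hE : hausdorff_space E) A (g : R^o -> E) t :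
  smooth_curve A g -> A t -> g @ t --> g t.
Proof. by move=> gA At; exact: (is_cderive_cvg (smooth_curve_cderive hE gA At)). Qed.

Lemma bump_bounded h : is_bump h -> exists2 M, 0 <= M & forall x, `|h x| <= M.
Proof.
move=> [hs h0].
have hc : {within `[-1, 1], continuous (fun x : R => `|h x| : R)}.
  apply: continuous_subspaceT => x.
  apply: (@continuous_comp _ _ _ h (fun y : R => `|y|)); last exact: norm_continuous.
  exact: (smooth_continuous (@haus_real R) hs).
have [z _ hz] := EVT_max (le_trans (lerN10 R) ler01) hc.
exists `|h z| => // x; have [x1|x1] := leP `|x| 1.
  by apply: hz; rewrite in_itv /= -ler_norml.
by rewrite h0 // normr0.
Qed.

Lemma bump_plateau : is_bump plateau.
Proof.
by split=> [|x /ltW]; [exact: smooth_plateau|exact: plateau_eq0].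
Qed.

(** A bounded substitute for the identity, equal to it for [|x| <= 1/2]: it localizes curves,
    carries the velocities of the special curve, and confines the test variations to [N]. *)
Lemma bump_Xplateau : is_bump (fun x => x * plateau x).
Proof.
split=> [|x /ltW x1]; last by rewrite plateau_eq0 ?mulr0.
apply: (@smoothZ _ R^o (@haus_real R)); first exact: openT.
  exact: smooth_id.
exact: smooth_plateau.
Qed.

Lemma Xplateau_le1 x : `|x * plateau x| <= 1.
Proof.
have [x1|x1] := leP 1 `|x|; first by rewrite plateau_eq0 // mulr0 normr0.
by rewrite normrM (ger0_norm (plateau_ge0 _)) mulr_ile1 ?plateau_ge0 ?plateau_le1 // ltW.
Qed.

End Plateau.

(** * Generating seminorms *)

Section Seminorm.
Context {R : realType} {E : tvsType R} (p : E -> R).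
Hypothesis ps : seminorm p.

Lemma seminorm0 : p 0 = 0.
Proof. by have [_ pZ] := ps; rewrite -(scale0r (0 : E)) pZ normr0 mul0r. Qed.

Lemma seminormN x : p (- x) = p x.
Proof. by have [_ pZ] := ps; rewrite -scaleN1r pZ normrN1 mul1r. Qed.

Lemma seminorm_ge0 x : 0 <= p x.
Proof.
have [pD _] := ps; have := pD x (- x); rewrite subrr seminorm0 seminormN.
by rewrite -mulr2n pmulrn_lge0.
Qed.

Lemma seminorm_sym x y : p (x - y) = p (y - x).
Proof. by rewrite -opprB seminormN. Qed.

Lemma seminorm_tri z x y : p (x - y) <= p (x - z) + p (z - y).
Proof. by have [pD _] := ps; rewrite (le_trans _ (pD _ _)) // addrA subrK. Qed.

End Seminorm.

Section Generating.
Context {R : realType} {E : tvsType R} (p : nat -> E -> R).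
Hypothesis gp : generating_seminorms p.

Definition sball n (x : E) (e : R) : set E :=
  [set y | forall i, (i <= n)%N -> p i (y - x) < e].

Lemma nbhs_translate (x : E) (U : set E) :
  nbhs x U <-> nbhs (0 : E) [set z | U (z + x)].
Proof.
split=> [xU|].
  have : (fun z : E => z + x) @ (0 : E) --> x.
    by rewrite -[X in _ --> X]add0r; apply: tvs_cvgD; [exact: cvg_id|exact: cvg_cst].
  by move=> /(_ _ xU).
move=> U0; have : (fun z : E => z - x) @ x --> (0 : E).
  rewrite -[X in _ --> X](subrr x).
  by apply: (@tvs_cvgB R E (nbhs x) _ E id (cst x) x x); [exact: cvg_id|exact: cvg_cst].
have -> : U = (fun z => z - x) @^-1` [set z | U (z + x)].
  by apply/funext => z /=; rewrite subrK.
by move=> /(_ _ U0).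
Qed.

Lemma nbhs_sball (x : E) (U : set E) :
  nbhs x U <-> exists n, exists2 e : R, 0 < e & sball n x e `<=` U.
Proof.
rewrite nbhs_translate (gp.2 _); split=> -[n [e e0 eU]]; exists n, e => //.
  by move=> y yx; rewrite -(subrK x y); exact: eU.
by move=> y yx; apply: eU => i ni; rewrite addrK; exact: yx.
Qed.

Lemma nbhs_seminorm i (x : E) (e : R) : 0 < e -> \forall y \near x, p i (y - x) < e.
Proof. by move=> e0; apply/nbhs_sball; exists i, e => // y; apply. Qed.

Lemma cvg_seminorm {T : Type} {F : set_system T} {FF : Filter F} (f : T -> E) (l : E) :
  f @ F --> l <-> forall i (e : R), 0 < e -> \forall x \near F, p i (f x - l) < e.
Proof.
split=> [fl i e e0|fl U /nbhs_sball[n [e e0 eU]]].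
  exact: (fl _ (nbhs_seminorm i l e0)).
have : \forall x \near F, forall i, (i < n.+1)%N -> p i (f x - l) < e.
  elim: n.+1 => [|m IH]; first by apply: filterE.
  have := fl m e e0; apply: filterS2 IH => x xm xM i; rewrite ltnS leq_eqVlt.
  by move=> /orP[/eqP->//|]; exact: xm.
by apply: filterS => x xe; apply: eU => i ni; exact: xe.
Qed.

Lemma cvg_seminorm_cvg {T : Type} {F : set_system T} {FF : Filter F} i (f : T -> E) (l : E) :
  f @ F --> l -> (fun x => p i (f x) : R^o) @ F --> p i l.
Proof.
move=> /cvg_seminorm/(_ i) fl; apply/cvgrPdist_lt => e /fl; apply: filterS => x xe.
have ps := gp.1 i.
have h1 := seminorm_tri ps 0 (f x) l; have := (ps.1 (f x - l) l); rewrite subrK.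
have := (ps.1 (l - f x) (f x)); rewrite subrK (seminorm_sym ps l) => h2 h3.
by rewrite ltr_norml; apply/andP; split; lra.
Qed.

End Generating.

Section GeneratingInstances.
Context {R : realType}.

Lemma generating_real : generating_seminorms (fun _ (x : R^o) => `|x|).
Proof.
split=> [_|U]; first by split=> [x y|a x]; [exact: ler_normD|exact: normrM].
split=> [/nbhs_ballP[e e0 eU]|[n [e e0 eU]]].
  exists 0%N, e => // x xe; apply: eU; rewrite -ball_normE /= sub0r normrN.
  exact: (xe 0%N (leqnn 0)).
by apply/nbhs_ballP; exists e => // x; rewrite -ball_normE /= sub0r normrN => xe; exact: eU.
Qed.

Lemma generating_prod {E G : tvsType R} (p : nat -> E -> R) (q : nat -> G -> R) :
  generating_seminorms p -> generating_seminorms q ->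
  @generating_seminorms R (E * G : tvsType R)%type (fun n z => p n z.1 + q n z.2).
Proof.
move=> gp gq; split=> [n|U].
  have [pD pZ] := gp.1 n; have [qD qZ] := gq.1 n.
  split=> [x y|a x] /=; last by rewrite pZ qZ mulrDr.
  by rewrite addrACA lerD.
split=> [[[A B] [/= /(gp.2 _)[n1 [e1 e10 A1]] /(gq.2 _)[n2 [e2 e20 B2]]] ABU]|].
  exists (maxn n1 n2), (Num.min e1 e2); first by rewrite lt_min e10.
  move=> [x y] /= xy; apply: ABU; split => /=; [apply: A1|apply: B2] => i ni /=.
    have /xy : (i <= maxn n1 n2)%N by rewrite leq_max ni.
    rewrite lt_min => /andP[+ _]; apply: le_lt_trans.
    by rewrite lerDl (seminorm_ge0 (gq.1 i)).
  have /xy : (i <= maxn n1 n2)%N by rewrite leq_max ni orbT.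
  rewrite lt_min => /andP[_]; apply: le_lt_trans.
  by rewrite lerDr (seminorm_ge0 (gp.1 i)).
move=> [n [e e0 eU]].
have e20 : 0 < e / 2 by rewrite divr_gt0.
exists (sball p n 0 (e / 2), sball q n 0 (e / 2)) => /=.
  by split; [apply/(nbhs_sball gp)|apply/(nbhs_sball gq)]; exists n, (e / 2).
move=> [x y] [/= px qy]; apply: eU => i ni /=.
have := px i ni; have := qy i ni; rewrite !subr0 => h1 h2.
by rewrite [e](splitr e) ltrD.
Qed.

End GeneratingInstances.

(** * Smoothness along curves is a local property *)

Section ArcLocal.
Context {R : realType} {E F : tvsType R}.
Hypotheses (hE : hausdorff_space E) (hF : hausdorff_space F).

Definition arc_smooth (U : set E) (f : E -> F) : Prop :=
  forall g : R^o -> E, smooth_curve setT g -> (forall t, U (g t)) ->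
    smooth_curve setT (f \o g).

Lemma iter_curve_derive_nearE {G : tvsType R} n (f g : R^o -> G) t :
  (\forall x \near t, g x = f x) ->
  iter n curve_derive g t = iter n curve_derive f t.
Proof. by move=> /(iter_curve_derive_near n)/nbhs_singleton. Qed.

Lemma smooth_curve_local {G : tvsType R} (hG : hausdorff_space G) A (g : R^o -> G) :
  (forall t, A t -> exists2 f : R^o -> G, smooth_curve setT f &
     \forall x \near t, f x = g x) -> smooth_curve A g.
Proof.
move=> loc n t At; have [f fs fg] := loc t At.
have := is_cderive_curve_derive hG (fs n t I).
move=> /(is_cderive_near (iter_curve_derive_near n fg)).
exact: is_cderive_derivable.
Qed.

(** Arc smoothness only tests curves defined on the whole line. Around [t0], [g] is therefore
    reparametrized by a smooth map [r] that is the identity near [t0] and never leaves a ball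
    contained in [A]. *)
Lemma arc_smooth_local (U : set E) (f : E -> F) (A : set R^o) (g : R^o -> E) :
  arc_smooth U f -> open A -> smooth_curve A g -> (forall t, A t -> U (g t)) ->
  smooth_curve A (f \o g).
Proof.
move=> fU oA gA AU; apply: smooth_curve_local => // t0 At0.
have /nbhs_ballP[d d0 dA] : nbhs t0 A by exact: open_nbhs_nbhs.
pose r (t : R^o) : R^o := t0 + (d / 2) * ((2 / d) * (t - t0) * plateau ((2 / d) * (t - t0))).
have rs : smooth_curve setT r.
  have lin : smooth_curve setT (fun t : R^o => (2 / d) * (t - t0) : R^o).
    apply: (@smoothZ _ R^o (@haus_real R) _ (cst (2 / d))); first exact: openT.
      exact: smooth_cst.
    apply: (@smoothD _ R^o (@haus_real R) _ id); first exact: openT.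
      exact: smooth_id.
    exact: smooth_cst.
  apply: (@smoothD _ R^o (@haus_real R) _ (cst t0)); first exact: openT.
    exact: smooth_cst.
  apply: (@smoothZ _ R^o (@haus_real R) _ (cst (d / 2))); first exact: openT.
    exact: smooth_cst.
  by have := smooth_comp (@haus_real R) openT openT (fun _ _ => I) lin bump_Xplateau.1.
have rA t : A (r t).
  apply: dA; rewrite -ball_normE /= /r opprD addNKr normrN normrM.
  rewrite gtr0_norm ?divr_gt0 // (@le_lt_trans _ _ (d / 2)) //; last first.
    by rewrite ltr_pdivrMr // ltr_pMr // ltr1n.
  by rewrite ler_piMr ?Xplateau_le1 // ltW // divr_gt0.
exists (f \o (g \o r)).
  apply: fU => [|t]; last exact/AU/rA.
  exact: (smooth_comp hE openT oA (fun t _ => rA t) rs gA).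
near=> t; rewrite /= /r plateau_eq1.
  rewrite mulr1 mulrA -{1}[d / 2]invf_div mulVf ?mul1r 1?addrC ?subrK //.
  by rewrite mulf_neq0 ?invr_neq0 // gt_eqF.
rewrite normrM gtr0_norm ?divr_gt0 // -ler_pdivlMl ?divr_gt0 // invf_div.
rewrite distrC ltW //; near: t.
apply: (@cvgr_dist_lt _ _ _ _ _ id); first exact: cvg_id.
by rewrite !mulr_gt0.
Unshelve. all: by end_near. Qed.

End ArcLocal.

(** * Smooth curves through rapidly converging points *)

Section SpecialCurve.
Context {R : realType} {E : tvsType R} (p : nat -> E -> R).
Hypotheses (hE : hausdorff_space E) (gp : generating_seminorms p).
Implicit Types (a b : nat -> E) (h : R^o -> R^o) (m : nat) (t : R^o).

(** All powers of [2 ^+ m] are required because each derivative of the [m]-th bump contributes a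
    factor [8 * 2 ^+ m]. *)
Definition rapid a := forall k i, exists C : R, forall m, 2 ^+ (m * k) * p i (a m) <= C.

(** With the factor [8] the [m]-th bump lives where [7/8 <= 2 ^+ m * t <= 9/8], and doubling this
    interval gives a disjoint one. *)
Definition rescaled m t : R^o := 8 * (2 ^+ m * t - 1).

(** The default index is harmless: if no index qualifies, a bump vanishes at [rescaled 0 t] too. *)
Definition active t : nat := xget 0%N [set m | `|rescaled m t| <= 1].

(* The sum over [m] of the bumps [h (rescaled m t) *: a m]: these have disjoint
   supports around the points [2 ^- m], so at most one of them is active at [t]. *)
Definition bump_sum h a t : E := h (rescaled (active t) t) *: a (active t).

(** Another active index would force [2 ^+ m * t <= 9/16] or [2 ^+ m * t >= 7/4]; the bounds [3/5]
    and [17/10] exclude both. They are strict, hence stable near [t], and the resulting windows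
    overlap and cover all [t > 0], the window of index [0] being unbounded above. *)
Lemma bump_sumE h a m t : is_bump h -> 3 / 5 < 2 ^+ m * t ->
  (m == 0%N) || (2 ^+ m * t < 17 / 10) -> bump_sum h a t = h (rescaled m t) *: a m.
Proof.
move=> [_ h0] mt mt'; rewrite /bump_sum /active; case: xgetP => [m' _ /= m't|none].
  move: m't; rewrite ler_norml /rescaled => /andP[m't1 m't2].
  have [mm'|mm'|->//] := ltngtP m m'.
    exfalso; suff : 2 * (2 ^+ m * t) <= 2 ^+ m' * t by lra.
    rewrite mulrA -exprS ler_pM2r ?ler_weXn2l ?ler1n //.
    have : 0 < (2 : R) ^+ m by rewrite exprn_gt0.
    by move=> /pmulr_rgt0 <-; lra.
  have m0 : (m == 0%N) = false by case: (m) mm'.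
  rewrite m0 /= in mt'.
  exfalso; suff : 2 * (2 ^+ m' * t) <= 2 ^+ m * t by lra.
  rewrite mulrA -exprS ler_pM2r ?ler_weXn2l ?ler1n //.
  have : 0 < (2 : R) ^+ m by rewrite exprn_gt0.
  by move=> /pmulr_rgt0 <-; lra.
have hn n : h (rescaled n t) = 0 by apply: h0; rewrite ltNge; apply/negP/none.
by rewrite !hn !scale0r.
Qed.

Lemma bump_sum_le0 h a t : is_bump h -> t <= 0 -> bump_sum h a t = 0.
Proof.
move=> [_ h0] t0; rewrite /bump_sum h0 ?scale0r // /rescaled.
have : 2 ^+ active t * t <= 0 by rewrite pmulr_rle0 // exprn_gt0.
by move=> h1; rewrite ltr_normr; apply/orP; right; lra.
Qed.

(** On the active bump [2 ^+ m * |t|] is at least [1/2], so rapidity of order [2] turns into a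
    factor [|t| ^+ 2]. Quadratic flatness is what makes the derivative at [0] vanish. *)
Lemma bump_sum_flat h a i : is_bump h -> rapid a ->
  exists2 C : R, 0 <= C & forall t, p i (bump_sum h a t) <= C * `|t| ^+ 2.
Proof.
move=> hb ra; have [M M0 hM] := bump_bounded hb; have [C aC] := ra 2%N i.
have C0 : 0 <= C.
  by apply: le_trans (aC 0%N); rewrite mul0n expr0 mul1r (seminorm_ge0 (gp.1 i)).
exists (4 * M * C); first by rewrite !mulr_ge0.
move=> t; rewrite /bump_sum (gp.1 i).2.
have [m1|m1] := leP `|rescaled (active t) t| 1; last first.
  by rewrite hb.2 // normr0 mul0r !mulr_ge0.
set m := active t in m1 *.
have h1 : 1 <= 4 * (2 ^+ m * `|t|) ^+ 2.
  have : 1 / 2 <= 2 ^+ m * `|t|.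
    have : 2 ^+ m * t <= 2 ^+ m * `|t| by rewrite ler_wpM2l ?exprn_ge0 ?ler_norm.
    by move: m1; rewrite ler_norml /rescaled => /andP[]; lra.
  by move=> ?; nra.
have h2 : p i (a m) <= 4 * `|t| ^+ 2 * (2 ^+ (m * 2) * p i (a m)).
  have := seminorm_ge0 (gp.1 i) (a m) => pa0.
  apply: le_trans (ler_peMl pa0 h1) _.
  by rewrite exprMn -exprM; lra.
apply: le_trans (ler_wpM2r (seminorm_ge0 (gp.1 i) _) (hM _)) _.
rewrite -!mulrA [4 * _]mulrCA ler_wpM2l //.
apply: le_trans h2 _; rewrite -!mulrA ler_wpM2l // [leRHS]mulrC.
by rewrite mulrA -expr2 ler_wpM2l ?exprn_ge0 // aC.
Qed.

Lemma rapidZ a : rapid a -> rapid (fun m => (8 * 2 ^+ m : R) *: a m).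
Proof.
move=> ra k i; have [C aC] := ra k.+1 i; exists (8 * C) => m.
rewrite (gp.1 i).2 gtr0_norm ?mulr_gt0 ?exprn_gt0 //.
have := aC m; rewrite mulnS exprD; lra.
Qed.

(** The derivative has the same shape with coefficients that are still rapid, so smoothness follows
    by induction over all [h] and [a]. Only [0], where the bumps accumulate, needs the flatness
    estimate. *)
Lemma is_cderive_bump_sum h a t : is_bump h -> rapid a ->
  is_cderive (bump_sum h a) t
    (bump_sum (curve_derive h) (fun m => (8 * 2 ^+ m : R) *: a m) t).
Proof.
move=> hb ra; have hb' := bump_derive hb.
have [t0|t0|t0] := ltgtP (t : R) 0.
- rewrite (bump_sum_le0 _ hb' (ltW t0)).
  apply: (@is_cderive_near _ _ (cst 0)); last exact: is_cderive_cst.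
  by near=> x; rewrite bump_sum_le0 //; near: x; exact: lt_le_nbhsl.
- have [m [m1 m2]] : exists m, 3 / 5 < 2 ^+ m * t /\ (m == 0%N) || (2 ^+ m * t < 17 / 10).
    have ex : exists m, 3 / 5 < 2 ^+ m * t.
      have [n nt] : exists n : nat, t^-1 < n%:R.
        by exists (Num.truncn t^-1).+1; exact: truncnS_gt.
      exists n; rewrite (@lt_le_trans _ _ 1) //; first by lra.
      rewrite -ler_pdivrMr // mul1r (le_trans (ltW nt)) //.
      by rewrite -natrX ler_nat ltnW // ltn_expl.
    (* For the least such index, if positive, [2 ^+ m * t] is at most [6/5], well below [17/10]. *)
    have [m m1 mmin] := ex_minnP ex; exists m; split => //.
    case: m m1 mmin => [//|m] m1 mmin; apply/orP; right.
    have := mmin m; rewrite ltnn; have [_ /(_ isT)//|h' _] := ltP (3 / 5) (2 ^+ m * t).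
    by rewrite exprS; lra.
  apply: (@is_cderive_near _ _ (fun x => h (rescaled m x) *: a m)).
    near=> x; rewrite (@bump_sumE h a m) //.
      near: x; apply: (@cvgr_gt _ _ _ _ (fun x : R^o => 2 ^+ m * x : R^o) (2 ^+ m * t)) => //.
      by apply: cvgM; [exact: cvg_cst|exact: cvg_id].
    near: x; have /orP[->|m2'] := m2; first by apply: nearW.
    suff : \forall x \near t, 2 ^+ m * x < 17 / 10 by apply: filterS => x ->; rewrite orbT.
    have ct : (2 ^+ m * x : R) @[x --> (t : R)] --> (2 ^+ m * t : R).
      by apply: cvgM; [exact: cvg_cst|exact: cvg_id].
    exact: (cvgr_lt _ ct _ m2').
  rewrite (bump_sumE _ hb' m1 m2).
  have rd : is_cderive (rescaled m) t (8 * 2 ^+ m : R).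
    have h1 := is_cderiveZ (is_cderive_cst (8 * 2 ^+ m : R^o) t) (is_cderive_id t).
    have := is_cderiveD h1 (is_cderive_cst (-8 : R^o) t).
    rewrite scale0r add0r addr0 /GRing.scale /= mulr1; congr is_cderive.
    by apply/funext => x; rewrite /rescaled; ring.
  have hd := smooth_curve_cderive (@haus_real R) hb.1 (I : setT (rescaled m t)).
  have := is_cderiveZ (is_cderive_comp rd hd) (is_cderive_cst (a m) t).
  by rewrite scaler0 addr0 scalerA [curve_derive h _ * _]mulrC.
- rewrite {}t0 bump_sum_le0 //; apply/is_cderiveP.
  exists (fun x => x^-1 *: bump_sum h a x); split.
  - apply/(cvg_seminorm gp) => i e e0.
    have [C C0 hC] := bump_sum_flat i hb ra.
    near=> x; rewrite subr0 (gp.1 i).2 normfV.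
    have [->|x0] := eqVneq x 0; first by rewrite normr0 invr0 mul0r.
    rewrite mulrC ltr_pdivrMr ?normr_gt0 // (le_lt_trans (hC x)) //.
    rewrite expr2 mulrA ltr_pM2r ?normr_gt0 //.
    rewrite (@le_lt_trans _ _ ((C + 1) * `|x|)) //; first by rewrite ler_wpM2r // lerDl.
    rewrite -ltr_pdivlMl ?ltr_wpDl // -[x]subr0 distrC; near: x.
    apply: (@cvgr_dist_lt _ _ _ _ _ id); first exact: cvg_id.
    by rewrite mulr_gt0 // invr_gt0 ltr_wpDl.
  - by rewrite invr0 scale0r.
  - move=> x; rewrite (bump_sum_le0 a hb (lexx 0)) add0r subr0 scalerA.
    have [->|x0] := eqVneq x 0; first by rewrite mul0r scale0r bump_sum_le0.
    by rewrite divff // scale1r.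
Unshelve. all: by end_near. Qed.

Lemma smooth_bump_sum h a : is_bump h -> rapid a -> smooth_curve setT (bump_sum h a).
Proof.
move=> hb ra; apply/(smooth_curveP hE _ openT) => n.
elim: n h a hb ra => //= n IH h a hb ra.
exists (bump_sum (curve_derive h) (fun m => (8 * 2 ^+ m : R) *: a m)).
  by move=> t _; exact: is_cderive_bump_sum.
by apply: IH; [exact: bump_derive|exact: rapidZ].
Qed.

End SpecialCurve.

(** * Local bounds on directional derivatives *)

Section IteratedDerivative.
Context {R : realType} {F : tvsType R}.
Hypothesis hF : hausdorff_space F.

Lemma iter_cderive_affine n A (g : R^o -> F) (e t0 t : R) :
  open A -> smooth_curve A g -> A (e * (t - t0)) ->
  iter n curve_derive (fun s : R^o => g (e * (s - t0))) (t : R^o) =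
  e ^+ n *: iter n curve_derive g (e * (t - t0)).
Proof.
move=> oA gA; elim: n t => [|n IH] t At; first by rewrite expr0 scale1r.
have aff : is_cderive (fun s : R^o => e * (s - t0) : R^o) t e.
  have := is_cderiveZ (is_cderive_cst (e : R^o) t)
    (is_cderiveD (is_cderive_id t) (is_cderive_cst (- t0 : R^o) t)).
  by rewrite scale0r add0r addr0 /GRing.scale /= mulr1.
have affA : \forall s \near (t : R^o), A (e * (s - t0)).
  exact: (is_cderive_cvg aff (open_nbhs_nbhs (conj oA At))).
rewrite iterS; apply: (is_cderiveE hF).
apply: (@is_cderive_near _ _ (fun s : R^o => e ^+ n *: iter n curve_derive g (e * (s - t0)))).
  by apply: filterS affA => s As; rewrite -IH.
have gd := is_cderive_curve_derive hF (gA n _ At).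
have := is_cderiveZ (is_cderive_cst (e ^+ n : R^o) t) (is_cderive_comp aff gd).
by rewrite scale0r add0r scalerA exprSr.
Qed.

End IteratedDerivative.

Section LocalBound.
Context {R : realType} {E F : tvsType R}.
Variables (p : nat -> E -> R) (q : nat -> F -> R).
Hypotheses (hE : hausdorff_space E) (hF : hausdorff_space F).
Hypotheses (gp : generating_seminorms p) (gq : generating_seminorms q).
Variables (U : set E) (f : E -> F).
Hypotheses (oU : open U) (fU : arc_smooth U f).

Definition line (y u : E) (r : R^o) : E := y + r *: u.

Lemma is_cderive_line y u r : is_cderive (line y u) r u.
Proof.
have := is_cderiveD (is_cderive_cst y r) (is_cderiveZ (is_cderive_id r) (is_cderive_cst u r)).
by rewrite add0r scaler0 addr0 scale1r.
Qed.

Lemma smooth_line y u : smooth_curve setT (line y u).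
Proof.
apply: (smoothD hE (openT : open setT)); first exact: smooth_cst.
by apply: (smoothZ hE openT); [exact: smooth_id|exact: smooth_cst].
Qed.

Lemma open_curve_preimage (g : R^o -> E) : smooth_curve setT g -> open (g @^-1` U).
Proof.
move=> gs; apply: open_comp => // t _; exact: (smooth_continuous hE gs).
Qed.

(** The pure derivative of order [n], homogeneous of degree [n] in [u]: the kind that smoothness
    along curves provides outright. *)
Definition dir_derive n (y u : E) : F := iter n curve_derive (f \o line y u) 0.

Lemma line0 y u : line y u 0 = y. Proof. by rewrite /line scale0r addr0. Qed.

Lemma smooth_f_line y u : smooth_curve (line y u @^-1` U) (f \o line y u).
Proof.
apply: (arc_smooth_local hE hF fU) => //.
  exact/open_curve_preimage/smooth_line.
exact: sub_smooth_curve (smooth_line y u).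
Qed.

(** Once [m >= k], [2 ^- (m * m)] beats [2 ^+ (m * k)]; the finitely many earlier terms enter the
    constant. The bound is only asked for [m >= i] because the [m]-th neighbourhood chosen later
    controls only the seminorms up to [m]. *)
Lemma rapid_sq (a : nat -> E) :
  (forall i, exists M : R, forall m, (i <= m)%N -> p i (a m) <= M * 2 ^- (m * m)) ->
  rapid p a.
Proof.
move=> aM k i; have [M hM] := aM i.
have M0 : 0 <= M.
  have := le_trans (seminorm_ge0 (gp.1 i) _) (hM i (leqnn i)).
  by rewrite pmulr_lge0 // invr_gt0 exprn_gt0.
pose K := maxn i k.
exists (M + \sum_(m < K) 2 ^+ (m * k) * p i (a m)) => m.
have pos j : 0 <= 2 ^+ (j * k) * p i (a j).
  by rewrite mulr_ge0 ?exprn_ge0 // (seminorm_ge0 (gp.1 i)).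
have [mK|] := ltnP m K.
  rewrite (bigD1 (Ordinal mK)) //= addrCA lerDl addr_ge0 //.
  by apply: sumr_ge0 => j _.
rewrite geq_max => /andP[im km].
apply: (@le_trans _ _ M); last by rewrite lerDl sumr_ge0.
apply: (@le_trans _ _ (2 ^+ (m * k) * (M * 2 ^- (m * m)))).
  by rewrite ler_wpM2l ?exprn_ge0 // hM.
rewrite mulrCA ler_piMr // ler_pdivrMr ?exprn_gt0 // mul1r.
by rewrite ler_weXn2l ?ler1n // leq_mul2l km orbT.
Qed.

(* Otherwise a smooth curve through points [y m] converging rapidly to [x], with
   velocity [2 ^- (m * m) *: u m] at time [2 ^- m], is mapped to a curve whose
   [n]-th derivative is unbounded near [0]. *)
Lemma local_bound n i (x v : E) : U x ->
  exists C : R, \forall z \near (x, v), q i (dir_derive n z.1 z.2) <= C.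
Proof.
move=> Ux; apply: contrapT => /forallNP nobound.
(* Points must converge rapidly, whereas directions need only stay bounded: they get multiplied by
   [2 ^- (m * m)]. *)
pose W m : set (E * E) := sball p m x (2 ^- (m * m)) `*` sball p m v 1.
have Wxv m : nbhs (x, v) (W m).
  exists (sball p m x (2 ^- (m * m)), sball p m v 1) => //=.
  split; apply/(nbhs_sball gp).
    by exists m, (2 ^- (m * m)) => //; rewrite invr_gt0 exprn_gt0.
  by exists m, 1.
(* A velocity [2 ^- (m * m) *: u] multiplies the [n]-th derivative by the [n]-th power of the
   weight; the threshold is chosen so that more than [m] survives. *)
have : forall m, exists z : E * E, W m z /\
    m%:R * 2 ^+ (m * m) ^+ n < q i (dir_derive n z.1 z.2).
  move=> m; apply: contrapT => /forallNP nz.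
  apply: (nobound (m%:R * 2 ^+ (m * m) ^+ n)).
  apply: filterS (Wxv m) => z Wz; rewrite leNgt; apply/negP => lt.
  by apply: (nz z).
move=> /choice[z hz].
pose y m := (z m).1; pose u m := (z m).2; pose e m : R := 2 ^- (m * m).
have e0 m : 0 < e m by rewrite invr_gt0 exprn_gt0.
pose a m : E := y m - x; pose b m : E := ((8 * 2 ^+ m)^-1 * e m : R) *: u m.
have ra : rapid p a.
  apply: rapid_sq => j; exists 1 => m jm; rewrite mul1r ltW //.
  exact: ((hz m).1.1 j jm).
have rb : rapid p b.
  apply: rapid_sq => j; exists (p j v + 1) => m jm.
  have um : p j (u m) <= p j v + 1.
    have := (hz m).1.2 j jm; rewrite -/(u m).
    by have := (gp.1 j).1 (u m - v) v; rewrite subrK; lra.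
  rewrite (gp.1 j).2 gtr0_norm ?mulr_gt0 ?invr_gt0 ?mulr_gt0 ?exprn_gt0 //.
  rewrite mulrC -/(e m) mulrA; apply: ler_wpM2r; first exact: ltW.
  apply: le_trans um; rewrite ler_piMr ?(seminorm_ge0 (gp.1 j)) //.
  rewrite invf_le1 ?mulr_gt0 ?exprn_gt0 // mulr_ege1 ?exprn_ege1 ?ler1n //.
(* The first sum carries the curve to [y m], and the second moves it linearly there; the factor
   [(8 * 2 ^+ m)^-1] in [b] undoes the slope of [rescaled m]. *)
pose c t := x + (bump_sum plateau a t + bump_sum (fun s => s * plateau s) b t).
have cs : smooth_curve setT c.
  apply: (smoothD hE openT); first exact: smooth_cst.
  apply: (smoothD hE openT).
    exact: (smooth_bump_sum hE gp bump_plateau).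
  exact: (smooth_bump_sum hE gp bump_Xplateau).
have c0 : c 0 = x.
  by rewrite /c !bump_sum_le0 ?addr0 //; [exact: bump_Xplateau|exact: bump_plateau].
have oA : open (c @^-1` U) by exact: open_curve_preimage.
have fcs : smooth_curve (c @^-1` U) (f \o c).
  by apply: (arc_smooth_local hE hF fU) => //; exact: sub_smooth_curve cs.
have A0 : (c @^-1` U) 0 by rewrite /= c0.
set G := iter n curve_derive (f \o c).
have Gc : G @ (0 : R^o) --> G 0.
  exact: (is_cderive_cvg (is_cderive_curve_derive hF (fcs n 0 A0))).
have Gb : \forall t \near (0 : R^o), q i (G t) < q i (G 0) + 1.
  apply: filterS ((cvg_seminorm gq _ _).1 Gc i 1 ltr01) => t ht.
  rewrite (le_lt_trans _ (_ : q i (G t - G 0) + q i (G 0) < _)) ?(addrC _ 1) ?ltrD2r //.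
  by have := (gq.1 i).1 (G t - G 0) (G 0); rewrite subrK.
have /nbhs_ballP[d /= d0 dA] : nbhs (0 : R^o)
    ([set t | q i (G t) < q i (G 0) + 1] `&` (c @^-1` U)).
  by apply: filterI => //; exact: (open_nbhs_nbhs (conj oA A0)).
(* One index serves two ends: [2 ^- m < d], and [m] exceeds the bound on [G] near [0]. *)
have [m md] : exists m : nat, d^-1 + (q i (G 0) + 1) < m%:R.
  by exists (Num.truncn (d^-1 + (q i (G 0) + 1))).+1; exact: truncnS_gt.
have q0 := seminorm_ge0 (gq.1 i) (G 0).
have dV0 : 0 < d^-1 by rewrite invr_gt0.
have tm0 : 0 < (2 : R) ^- m by rewrite invr_gt0 exprn_gt0.
have tmd : ball (0 : R^o) d (2 ^- m : R).
  rewrite -ball_normE /= sub0r normrN gtr0_norm //.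
  rewrite invf_plt ?posrE ?exprn_gt0 //.
  apply: (@lt_le_trans _ _ m%:R); first by lra.
  by rewrite -natrX ler_nat ltnW // ltn_expl.
have [Gtm Atm] := dA _ tmd.
have cE : \forall t \near (2 ^- m : R^o), c t = line (y m) (u m) (e m * (t - 2 ^- m)).
  (* The radius gives [|rescaled m t| <= 8/16], the range where [plateau] is [1]. *)
  have close : \forall t \near (2 ^- m : R^o), `|2 ^- m - t| < 2 ^- m / 16.
    apply: (@cvgr_dist_lt _ _ _ (nbhs (2 ^- m : R^o)) _ id); [exact: cvg_id|by rewrite
      divr_gt0].
  apply: filterS close => t tm.
  have lam : 2 ^+ m * 2 ^- m = 1 :> R by rewrite divff // gt_eqF // exprn_gt0.
  have tm' : `|2 ^+ m * t - 1| < 16^-1.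
    have -> : 2 ^+ m * t - 1 = 2 ^+ m * (t - 2 ^- m) by rewrite mulrBr lam.
    rewrite normrM gtr0_norm ?exprn_gt0 // distrC.
    by rewrite -ltr_pdivlMl ?exprn_gt0.
  have rt : `|rescaled m t| <= 2^-1 by rewrite /rescaled normrM ger0_norm //; lra.
  move: tm'; rewrite ltr_norml => /andP[t1 t2].
  have h1 : 3 / 5 < 2 ^+ m * t by lra.
  have h2 : (m == 0%N) || (2 ^+ m * t < 17 / 10) by apply/orP; right; lra.
  rewrite /c (bump_sumE a bump_plateau h1 h2) (bump_sumE b bump_Xplateau h1 h2).
  rewrite (plateau_eq1 rt) scale1r mulr1 /a addrA [x + _]addrC subrK /line; congr (_ + _).
  rewrite /b scalerA; congr (_ *: _); rewrite /rescaled.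
  have l0 : (2 : R) ^+ m != 0 by rewrite gt_eqF // exprn_gt0.
  have -> : 2 ^+ m * t - 1 = 2 ^+ m * (t - 2 ^- m) by rewrite mulrBr lam.
  by rewrite [8 * _]mulrA [LHS]mulrACA mulfV ?mulf_neq0 // mul1r mulrC.
have ctm : c (2 ^- m : R) = y m.
  by rewrite (nbhs_singleton cE) subrr mulr0 line0.
have GE : G (2 ^- m) = e m ^+ n *: dir_derive n (y m) (u m).
  have near_eq : \forall t \near (2 ^- m : R^o),
      (f \o c) t = (f \o line (y m) (u m)) (e m * (t - 2 ^- m)).
    by apply: filterS cE => t /= ->.
  rewrite /G (iter_curve_derive_nearE n near_eq).
  have oL := open_curve_preimage (smooth_line (y m) (u m)).
  rewrite (iter_cderive_affine hF n oL (@smooth_f_line (y m) (u m))).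
    by rewrite subrr mulr0.
  by rewrite /= subrr mulr0 line0 -ctm.
have := (hz m).2; rewrite -/(y m) -/(u m) => big.
have eE : e m ^+ n * (2 ^+ (m * m)) ^+ n = 1 :> R.
  by rewrite -exprMn mulVf ?expr1n // gt_eqF // exprn_gt0.
have {}Gtm : q i (G (2 ^- m)) < q i (G 0) + 1 := Gtm.
move: Gtm; rewrite GE (gq.1 i).2 gtr0_norm ?exprn_gt0 // => Gtm.
have : m%:R < e m ^+ n * q i (dir_derive n (y m) (u m)).
  by move: big; rewrite -(ltr_pM2l (exprn_gt0 n (e0 m))) mulrCA eE mulr1.
lra.
Qed.

End LocalBound.

(** * Mean value inequality and Taylor estimates for seminorms *)

Lemma is_cderiveNZ {R : realType} {E : tvsType R} (h : R^o -> R^o) (dh r : R^o) (v : E) :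
  is_cderive h r dh -> is_cderive (fun s => - (h s *: v)) r (- (dh *: v)).
Proof.
move=> hh; have := is_cderiveZ (is_cderive_cst (-1 : R^o) r) (is_cderiveZ hh (is_cderive_cst
  v r)).
rewrite scale0r add0r scaler0 addr0 /cst scaleN1r; congr is_cderive.
by apply/funext => s; rewrite scaleN1r.
Qed.

Lemma is_cderive_sqr_half {R : realType} (r : R^o) :
  is_cderive (fun s : R^o => s ^+ 2 / 2 : R^o) r r.
Proof.
have := is_cderiveZ (is_cderive_cst (2^-1 : R^o) r) (is_cderiveZ (is_cderive_id r)
  (is_cderive_id r)).
rewrite scale0r add0r /cst /GRing.scale /= mulr1 mul1r.
have -> : 2^-1 * (r + r) = r by field.
by congr is_cderive; apply/funext => s; rewrite expr2 mulrC.
Qed.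

Section MeanValue.
Context {R : realType} {F : tvsType R} (q : nat -> F -> R).
Hypothesis gq : generating_seminorms q.
Implicit Types (g : R^o -> F) (a b t M : R) (i : nat).

(** Without linear functionals: [phi], the seminorm of the increment minus a line of slope [M + d],
    attains its maximum. At a maximum [r0 > a], the increments of [g] just to the left of [r0] have
    slope below [M + d], so [phi] would be larger there; hence the maximum is at [a]. *)
Lemma seminorm_mvt i g g' a b M : a <= b ->
  (forall r : R, a <= r <= b -> is_cderive g r (g' r)) ->
  (forall r : R, a <= r <= b -> q i (g' r) <= M) ->
  q i (g b - g a) <= M * (b - a).
Proof.
move=> ab gg' g'M; have qs := gq.1 i.
apply/ler_addgt0Pr => _/posnumP[e].
have [->|ba] := eqVneq b a; first by rewrite !subrr mulr0 add0r (seminorm0 qs).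
have ba0 : 0 < b - a by rewrite subr_gt0 lt_neqAle eq_sym ba ab.
pose d := e%:num / (b - a); have d0 : 0 < d by rewrite divr_gt0.
pose phi (r : R) : R := q i (g r - g a) - (M + d) * (r - a).
suff : phi b <= phi a.
  rewrite /phi !subrr mulr0 subr0 (seminorm0 qs) subr_le0 mulrDl.
  by rewrite /d divfK // gt_eqF.
have phic : {within `[a, b], continuous phi}.
  apply: continuous_in_subspaceT => r; rewrite inE /= in_itv /= => rab.
  apply: cvgB; last first.
    by apply: cvgM; [exact: cvg_cst|apply: cvgB; [exact: cvg_id|exact: cvg_cst]].
  apply: (@cvg_seminorm_cvg _ _ q gq _ (nbhs (r : R^o)) _ i (fun s => g s - g a)).
  by apply: tvs_cvgB; [exact: is_cderive_cvg (gg' r rab)|exact: cvg_cst].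
have [r0 + rmax] := EVT_max ab phic; rewrite in_itv /= => r0ab.
have [<-|r0a] := eqVneq r0 a; first by apply: rmax; rewrite in_itv /= ab lexx.
have ar0 : a < r0 by rewrite lt_neqAle eq_sym r0a; case/andP: r0ab.
have /is_cderiveP[k [kc k0 gk]] := gg' r0 r0ab.
have kM : \forall s \near (r0 : R^o), q i (k s) < M + d.
  apply: filterS ((cvg_seminorm gq _ _).1 kc i d d0) => s ks.
  have := qs.1 (k s - g' r0) (g' r0); rewrite subrK => h.
  by have := g'M _ r0ab; lra.
exfalso; near (r0 : R^o)^'- => s.
have sr0 : s < r0 by near: s; exact: nbhs_left_lt.
have as_ : a < s by near: s; exact: nbhs_left_gt.
have ks : q i (k s) < M + d by near: s; exact: (cvg_within _ kM).
have sb : s <= b by apply: le_trans (ltW sr0) _; case/andP: r0ab.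
have := rmax s; rewrite in_itv /= (ltW as_) sb => /(_ isT).
apply/negP; rewrite -ltNge /phi.
have h1 := seminorm_tri qs (g s) (g r0) (g a).
have h2 : q i (g r0 - g s) < (M + d) * (r0 - s).
  rewrite (seminorm_sym qs) (gk s) addrAC subrr add0r qs.2 mulrC.
  by rewrite distrC gtr0_norm ?subr_gt0 // ltr_pM2r // subr_gt0.
by move: h1 h2; lra.
Unshelve. all: by end_near. Qed.

Lemma seminorm_mvt0 i g g' t M :
  (forall r : R, `|r| <= `|t| -> is_cderive g r (g' r)) ->
  (forall r : R, `|r| <= `|t| -> q i (g' r) <= M) ->
  q i (g t - g 0) <= M * `|t|.
Proof.
move=> gg' g'M; have [t0|t0] := leP 0 t.
  rewrite ger0_norm // -[X in _ * X]subr0.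
  apply: (seminorm_mvt t0) => r /andP[r0 rt]; [apply: gg'|apply: g'M];
    by rewrite !ger0_norm.
rewrite (seminorm_sym (gq.1 i)) ltr0_norm // -[X in _ * X]add0r.
apply: (seminorm_mvt (ltW t0)) => r /andP[tr r0]; [apply: gg'|apply: g'M];
  by rewrite (ler0_norm r0) ltr0_norm // lerN2.
Qed.

(** Two nested uses of the mean value inequality; the factor [1/2] of the sharp remainder is given
    up. *)
Lemma seminorm_taylor2 i g g1 g2 t M :
  (forall r : R, `|r| <= `|t| -> is_cderive g r (g1 r)) ->
  (forall r : R, `|r| <= `|t| -> is_cderive g1 r (g2 r)) ->
  (forall r : R, `|r| <= `|t| -> q i (g2 r) <= M) ->
  q i (g t - g 0 - t *: g1 0) <= M * `|t| ^+ 2.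
Proof.
move=> gg1 g12 g2M.
have M0 : 0 <= M.
  by apply: le_trans (g2M 0 _); rewrite ?(seminorm_ge0 (gq.1 i)) // normr0.
have := @seminorm_mvt0 i (fun r => g r - r *: g1 0) (fun r => g1 r - g1 0) t (M * `|t|).
rewrite scale0r subr0 -[M * _ * _]mulrA -expr2 addrAC; apply=> r rt.
  apply: is_cderiveD; first exact: gg1.
  by have := is_cderiveNZ (v := g1 0) (is_cderive_id r); rewrite scale1r.
apply: le_trans (_ : M * `|r| <= _); last by rewrite ler_wpM2l.
apply: seminorm_mvt0 => s sr; [apply: g12|apply: g2M]; exact: le_trans sr rt.
Qed.

Lemma seminorm_taylor3 i g g1 g2 g3 t M :
  (forall r : R, `|r| <= `|t| -> is_cderive g r (g1 r)) ->
  (forall r : R, `|r| <= `|t| -> is_cderive g1 r (g2 r)) ->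
  (forall r : R, `|r| <= `|t| -> is_cderive g2 r (g3 r)) ->
  (forall r : R, `|r| <= `|t| -> q i (g3 r) <= M) ->
  q i (g t - g 0 - t *: g1 0 - (t ^+ 2 / 2) *: g2 0) <= M * `|t| ^+ 3.
Proof.
move=> gg1 g12 g23 g3M.
have M0 : 0 <= M.
  by apply: le_trans (g3M 0 _); rewrite ?(seminorm_ge0 (gq.1 i)) // normr0.
have := @seminorm_mvt0 i (fun r => g r - r *: g1 0 - (r ^+ 2 / 2) *: g2 0)
  (fun r => g1 r - g1 0 - r *: g2 0) t (M * `|t| ^+ 2).
rewrite scale0r subr0 expr0n /= mul0r scale0r subr0 -[M * _ * _]mulrA -exprSr.
have -> : g t - t *: g1 0 - (t ^+ 2 / 2) *: g2 0 - g 0 =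
          g t - g 0 - t *: g1 0 - (t ^+ 2 / 2) *: g2 0.
  by rewrite [LHS]addrAC [g t - _ - g 0]addrAC.
apply=> r rt.
  apply: is_cderiveD; first (apply: is_cderiveD; first exact: gg1).
    by have := is_cderiveNZ (v := g1 0) (is_cderive_id r); rewrite scale1r.
  exact: is_cderiveNZ (@is_cderive_sqr_half _ r).
apply: le_trans (_ : M * `|r| ^+ 2 <= _); last by rewrite ler_wpM2l // lerXn2r ?nnegrE.
by apply: (@seminorm_taylor2 i g1 g2 g3) => s sr; [apply: g12|apply: g23|apply: g3M]; exact:
  le_trans sr rt.
Qed.

End MeanValue.

Section StrictDerivative.
Context {R : realType} {E F : tvsType R}.
Variables (p : nat -> E -> R) (q : nat -> F -> R).
Hypotheses (hE : hausdorff_space E) (hF : hausdorff_space F).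
Hypotheses (gp : generating_seminorms p) (gq : generating_seminorms q).
Variables (U : set E) (f : E -> F).
Hypotheses (oU : open U) (fU : arc_smooth U f).

Lemma cvg_line {T : Type} {G : set_system T} {FG : Filter G}
    (y u : T -> E) (r : T -> R^o) x v t :
  y @ G --> x -> u @ G --> v -> r @ G --> t ->
  (fun w => line (y w) (u w) (r w)) @ G --> line x v t.
Proof. by move=> yx uv rt; apply: tvs_cvgD => //; exact: tvs_cvgZ. Qed.

Lemma line_line (y u : E) (r s : R) : line (line y u r) u s = line y u (r + s).
Proof. by rewrite /line -addrA -scalerDl. Qed.

Lemma dir_derive_line n y u r : U (line y u r) ->
  dir_derive f n (line y u r) u = iter n curve_derive (f \o line y u) r.
Proof.
move=> Ur; rewrite /dir_derive.
have oL := open_curve_preimage hE oU (smooth_line hE y u).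
have := @iter_cderive_affine _ _ hF n _ (f \o line y u) 1 (- r) 0 oL.
rewrite mul1r opprK add0r expr1n scale1r => <- //.
  congr (iter n curve_derive _ 0); apply/funext => s.
  by rewrite /= line_line mul1r addrC.
exact: smooth_f_line.
Qed.

Lemma is_cderive_dir_derive n y u r : U (line y u r) ->
  is_cderive (fun s => dir_derive f n (line y u s) u) r
    (dir_derive f n.+1 (line y u r) u).
Proof.
move=> Ur; have oL := open_curve_preimage hE oU (smooth_line hE y u).
apply: (@is_cderive_near _ _ (iter n curve_derive (f \o line y u))).
  by apply: filterS (open_nbhs_nbhs (conj oL Ur)) => s Us; rewrite dir_derive_line.
rewrite dir_derive_line //; apply: is_cderive_curve_derive => //.
exact: (@smooth_f_line _ _ _ hE hF _ _ oU fU).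
Qed.

Lemma dir_derive0 y u : dir_derive f 0 y u = f y.
Proof. by rewrite /dir_derive /= line0. Qed.

(** Balls around [0] are symmetric and contain every smaller step, so a property near [(x, v)] holds
    along whole segments, as the mean value inequality requires. *)
Lemma near_segment (x v : E) (P : set (E * E)) :
  (\forall z \near (x, v), P z) ->
  \forall w \near ((x, v), (0 : R^o)),
    forall r : R, `|r| <= `|w.2| -> P (line w.1.1 w.1.2 r, w.1.2).
Proof.
move=> Pxv.
have c : (fun w : (E * E) * R^o => (line w.1.1 w.1.2 w.2, w.1.2)) @ ((x, v), (0 : R^o)) -->
  (x, v).
  have c1 : (fun w : (E * E) * R^o => w.1) @ ((x, v), (0 : R^o)) --> (x, v) by exact: cvg_fst.
  have cu : (fun w : (E * E) * R^o => w.1.2) @ ((x, v), (0 : R^o)) --> v.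
    exact: (cvg_comp _ _ c1 cvg_snd).
  have cy : (fun w : (E * E) * R^o => w.1.1) @ ((x, v), (0 : R^o)) --> x.
    exact: (cvg_comp _ _ c1 cvg_fst).
  have ct : (fun w : (E * E) * R^o => w.2) @ ((x, v), (0 : R^o)) --> (0 : R^o).
    exact: cvg_snd.
  have : (fun w : (E * E) * R^o => line w.1.1 w.1.2 w.2) @ ((x, v), (0 : R^o)) --> line x v 0.
    exact: cvg_line.
  by rewrite line0 => cl; exact: (cvg_pair cl cu).
have [[A B] [/= xvA /nbhs_ballP[d /= d0 dB]] ABP] := c _ Pxv.
exists (A, ball (0 : R^o) d) => /=; first by split => //; exact: nbhsx_ballx.
move=> [z t] [/= Az]; rewrite -ball_normE /= sub0r normrN => td r rt.
apply: (ABP (z, r)); split => //=; apply: dB.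
by rewrite -ball_normE /= sub0r normrN (le_lt_trans rt).
Qed.

Lemma near_U (x v : E) : U x -> \forall z \near (x, v), U z.1.
Proof.
move=> Ux; have : (fun z : E * E => z.1) @ (x, v) --> x by exact: cvg_fst.
by move=> /(_ _ (open_nbhs_nbhs (conj oU Ux))).
Qed.

Lemma near_segment_bound n i (x v : E) : U x ->
  exists C : R, \forall w \near ((x, v), (0 : R^o)),
    forall r : R, `|r| <= `|w.2| -> U (line w.1.1 w.1.2 r) /\
      q i (dir_derive f n (line w.1.1 w.1.2 r) w.1.2) <= C.
Proof.
move=> Ux; have [C hC] := local_bound hE hF gp gq oU fU n i v Ux; exists C.
by apply: filterS (near_segment (filterI (near_U v Ux) hC)) => w h r /h.
Qed.

Lemma near_taylor2 n i (x v : E) : U x ->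
  exists C : R, \forall w \near ((x, v), (0 : R^o)),
    q i (dir_derive f n (line w.1.1 w.1.2 w.2) w.1.2 - dir_derive f n w.1.1 w.1.2
         - w.2 *: dir_derive f n.+1 w.1.1 w.1.2) <= C * `|w.2| ^+ 2.
Proof.
move=> Ux; have [C hC] := near_segment_bound n.+2 i v Ux; exists C.
apply: filterS hC => -[[y u] t] /= h.
have := @seminorm_taylor2 _ _ q gq i (fun s => dir_derive f n (line y u s) u)
  (fun s => dir_derive f n.+1 (line y u s) u) (fun s => dir_derive f n.+2 (line y u s) u) t C.
rewrite line0; apply=> r /h[Ur qr] //; exact: is_cderive_dir_derive.
Qed.

Lemma near_taylor3 i (x v : E) : U x ->
  exists C : R, \forall w \near ((x, v), (0 : R^o)),
    q i (f (line w.1.1 w.1.2 w.2) - f w.1.1 - w.2 *: dir_derive f 1 w.1.1 w.1.2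
         - (w.2 ^+ 2 / 2) *: dir_derive f 2 w.1.1 w.1.2) <= C * `|w.2| ^+ 3.
Proof.
move=> Ux; have [C hC] := near_segment_bound 3 i v Ux; exists C.
apply: filterS hC => -[[y u] t] /= h.
have := @seminorm_taylor3 _ _ q gq i (fun s => dir_derive f 0 (line y u s) u)
  (fun s => dir_derive f 1 (line y u s) u) (fun s => dir_derive f 2 (line y u s) u)
  (fun s => dir_derive f 3 (line y u s) u) t C.
rewrite line0 !dir_derive0; apply=> r /h[Ur qr] //; exact: is_cderive_dir_derive.
Qed.

(** The first derivative is bounded by some [C] along short segments with direction near [0]. Fix a
    small step [t] and write [y = x + t u]: for [y] near [x] the direction [u] is near [0], and the
    mean value inequality bounds the increment by [C * t]. *)
Lemma arc_smooth_continuous x : U x -> f @ x --> f x.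
Proof.
move=> Ux; apply/(cvg_seminorm gq) => i e e0.
have [C hC] := near_segment_bound 1 i 0 Ux.
have [[A B] [/= xA /nbhs_ballP[d /= d0 dB]] AB] := hC.
pose t : R := Num.min (d / 2) (e / (2 * (`|C| + 1))).
have C1 : 0 < `|C| + 1 by rewrite ltr_wpDl.
have t0 : 0 < t by rewrite lt_min !divr_gt0 ?mulr_gt0.
have td : B t.
  apply: dB; rewrite -ball_normE /= sub0r normrN gtr0_norm // gt_min.
  by rewrite ltr_pdivrMr // ltr_pMr // ltr1n.
have tC : (`|C| + 1) * t < e.
  have : t <= e / (2 * (`|C| + 1)) by rewrite ge_min lexx orbT.
  by rewrite ler_pdivlMr ?mulr_gt0 //; lra.
have cu : (fun y : E => (x, t^-1 *: (y - x))) @ x --> (x, (0 : E)).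
  have c0 : (fun y : E => y - x) @ x --> x - x.
    by apply: (@tvs_cvgB R E (nbhs x) _ E id (cst x) x x); [exact: cvg_id|exact: cvg_cst].
  have c1 : (fun y : E => t^-1 *: (y - x)) @ x --> t^-1 *: (x - x).
    by apply: (@tvs_cvgZ _ _ _ _ _ (cst (t^-1 : R^o))) => //; exact: cvg_cst.
  by rewrite subrr scaler0 in c1; apply: cvg_pair c1; exact: cvg_cst.
have cuA : \forall y \near x, A (x, t^-1 *: (y - x)) by exact: cu.
apply: filterS cuA => y Ay.
have h := AB (_, t) (conj Ay td); rewrite /= in h.
have yE : line x (t^-1 *: (y - x)) t = y.
  by rewrite /line scalerA divff ?gt_eqF // scale1r addrC subrK.
have := @seminorm_mvt0 _ _ q gq i (fun s => dir_derive f 0 (line x (t^-1 *: (y - x)) s) (t^-1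
  *: (y - x)))
  (fun s => dir_derive f 1 (line x (t^-1 *: (y - x)) s) (t^-1 *: (y - x))) t C.
rewrite yE line0 !dir_derive0 (gtr0_norm t0) => mvt.
apply: le_lt_trans (mvt _ _) _.
- by move=> r rt; apply: is_cderive_dir_derive; case: (h r) => //; rewrite (gtr0_norm t0).
- by move=> r rt; case: (h r) => //; rewrite (gtr0_norm t0).
- apply: le_lt_trans tC; rewrite ler_wpM2r ?(ltW t0) //.
  by rewrite (le_trans (ler_norm _)) // lerDl.
Qed.

End StrictDerivative.

(** * Comparison of linear combinations *)

Section LinearExpressions.
Context {R : comPzRingType} {V : lmodType R}.

(** Reified linear combinations: an identity of vectors reduces to identities between scalar
    coefficients. *)
Inductive lexp := LVar of nat | LZero | LAdd of lexp & lexp | LOpp of lexp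
  | LScale of R & lexp.

Fixpoint leval (env : seq V) (e : lexp) : V :=
  match e with
  | LVar i => nth 0 env i
  | LZero => 0
  | LAdd a b => leval env a + leval env b
  | LOpp a => - leval env a
  | LScale k a => k *: leval env a
  end.

Fixpoint lcoef (e : lexp) (i : nat) : R :=
  match e with
  | LVar j => if Nat.eqb i j then 1 else 0
  | LZero => 0
  | LAdd a b => lcoef a i + lcoef b i
  | LOpp a => - lcoef a i
  | LScale k a => k * lcoef a i
  end.

(* [lcoef] without the additions of and multiplications by zero, which would
   otherwise dominate the cost of the comparison of coefficients. *)
Fixpoint ocoef (e : lexp) (i : nat) : option R :=
  match e with
  | LVar j => if Nat.eqb i j then Some 1 else None
  | LZero => None
  | LAdd a b => match ocoef a i, ocoef b i with
                | Some x, Some y => Some (x + y)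
                | Some x, None => Some x
                | None, y => y
                end
  | LOpp a => match ocoef a i with Some x => Some (- x) | None => None end
  | LScale k a => match ocoef a i with Some x => Some (k * x) | None => None end
  end.

Lemma ocoefE e i : lcoef e i = match ocoef e i with Some x => x | None => 0 end.
Proof.
elim: e => //= [j|a -> b ->|a ->|k a ->]; first by case: Nat.eqb.
- by case: (ocoef a i) (ocoef b i) => [x|] [y|]; rewrite ?addr0 ?add0r.
- by case: (ocoef a i) => // ; rewrite oppr0.
- by case: (ocoef a i) => // ; rewrite mulr0.
Qed.

Fixpoint same_coef (n : nat) (a b : lexp) : Prop :=
  if n is n'.+1 then
    match ocoef a n', ocoef b n' with
    | Some x, Some y => x = y
    | Some x, None => x = 0
    | None, Some y => 0 = y
    | None, None => True
    end /\ same_coef n' a b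
  else True.

Lemma levalE env e : leval env e = \sum_(i < size env) lcoef e i *: nth 0 env i.
Proof.
elim: e => /= [j||a -> b ->|a ->|k a ->].
- have [jn|nj] := ltnP j (size env).
    rewrite (bigD1 (Ordinal jn)) //= big1 ?addr0 => [|i ij].
      by rewrite (_ : Nat.eqb j j) ?scale1r //; apply/PeanoNat.Nat.eqb_eq.
    case: PeanoNat.Nat.eqb_spec => [ji|_]; last by rewrite scale0r.
    by case/eqP: ij; apply: val_inj.
  rewrite nth_default // big1 // => i _.
  case: PeanoNat.Nat.eqb_spec => [ij|_]; last by rewrite scale0r.
  by have := ltn_ord i; rewrite ij ltnNge nj.
- by rewrite big1 // => i _; rewrite scale0r.
- by rewrite -big_split; apply: eq_bigr => i _; rewrite scalerDl.
- by rewrite -sumrN; apply: eq_bigr => i _; rewrite scaleNr.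
- by rewrite scaler_sumr; apply: eq_bigr => i _; rewrite scalerA.
Qed.

Lemma leval_eq env a b : same_coef (size env) a b -> leval env a = leval env b.
Proof.
move=> ab; rewrite !levalE; apply: eq_bigr => i _; congr (_ *: _).
elim: (size env) ab i => [|n IH] /= ab; first by case.
move=> i; have := ltn_ord i; rewrite ltnS leq_eqVlt => /orP[/eqP->|lt].
  by case: ab => + _; rewrite !ocoefE; case: (ocoef a n); case: (ocoef b n).
by have := IH ab.2 (Ordinal lt).
Qed.

End LinearExpressions.

Ltac lin_add env x :=
  let rec mem l := lazymatch l with
    | ?y :: ?l' => tryif constr_eq x y then idtac else mem l'
    | _ => fail end in
  match constr:(tt) with
  | _ => let _ := match goal with _ => mem env end in env
  | _ => constr:(x :: env)
  end.

Ltac lin_atoms env e :=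
  lazymatch e with
  | ?a + ?b => let env' := lin_atoms env a in lin_atoms env' b
  | - ?a => lin_atoms env a
  | ?k *: ?a => lin_atoms env a
  | 0 => env
  | _ => lin_add env e
  end.

Ltac lin_index env x :=
  lazymatch env with
  | ?y :: ?l => match constr:(tt) with
     | _ => let _ := match goal with _ => constr_eq x y end in constr:(O)
     | _ => let n := lin_index l x in constr:(S n) end
  end.

Ltac lin_reify R env e :=
  lazymatch e with
  | ?a + ?b => let a' := lin_reify R env a in let b' := lin_reify R env b in
               constr:(@LAdd R a' b')
  | - ?a => let a' := lin_reify R env a in constr:(@LOpp R a')
  | ?k *: ?a => let a' := lin_reify R env a in constr:(@LScale R k a')
  | 0 => constr:(@LZero R)
  | _ => let n := lin_index env e in constr:(@LVar R n)
  end.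

(* Proves an equality of linear combinations in a module over the field [R],
   by comparing the coefficients. *)
Ltac lin R V :=
  lazymatch goal with
  | |- @eq ?T ?x ?y =>
    let env := lin_atoms (@nil T) x in
    let env := lin_atoms env y in
    let a := lin_reify R env x in
    let b := lin_reify R env y in
    refine (@leval_eq R V env a b _); simpl; repeat split; rewrite ?mulr1; try (first [by []
      | ring | by field])
  end.

(** The final error count of [mixed_strict]: six Taylor remainders and four comparisons of second
    derivatives. *)
Lemma cubic_bound {R : realFieldType} (a b c d e f t eps : R) :
  (a + b + c + d + e + f) * t * t ^+ 2 <= eps / 2 * t ^+ 2 ->
  a * t ^+ 3 + b * t ^+ 3 + c * t ^+ 3 + d * t ^+ 3 + e * t ^+ 3 + f * t ^+ 3 +
  (t ^+ 2 / 2 * (eps / 6) + t ^+ 2 / 2 * (eps / 6) +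
   (t ^+ 2 * (eps / 6) + t ^+ 2 * (eps / 6))) <= t * (eps * t).
Proof. by rewrite !exprS expr0; lra. Qed.

(** * Strict derivatives and mixed second derivatives *)

Section StrictDerivativeTheory.
Context {R : realType} {E F : tvsType R}.
Variables (p : nat -> E -> R) (q : nat -> F -> R).
Hypotheses (hE : hausdorff_space E) (hF : hausdorff_space F).
Hypotheses (gp : generating_seminorms p) (gq : generating_seminorms q).
Variables (U : set E) (f : E -> F).
Hypotheses (oU : open U) (fU : arc_smooth U f).

Lemma near0_pos (P : set R^o) (C e : R) : nbhs (0 : R^o) P -> 0 < e ->
  exists t : R, [/\ 0 < t, P t & C * t < e].
Proof.
move=> P0 e0; near (0 : R^o)^'+ => t.
have t0 : 0 < t by near: t; exact: nbhs_right_gt.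
exists t; split => //; first by near: t; exact: (cvg_within _ P0).
apply: le_lt_trans (_ : (`|C| + 1) * t < _).
  by rewrite ler_pM2r // (le_trans (ler_norm _)) // lerDl.
rewrite mulrC -ltr_pdivlMr ?ltr_wpDl //; near: t.
by apply: nbhs_right_lt; rewrite divr_gt0 // ltr_wpDl.
Unshelve. all: by end_near. Qed.

Lemma seminormD4 i (a b c d : F) :
  q i (a + b + c + d) <= q i a + q i b + q i c + q i d.
Proof.
have [qD _] := gq.1 i.
by apply: le_trans (qD _ _) _; rewrite lerD2r (le_trans (qD _ _)) // lerD2r qD.
Qed.

Lemma cvg_line_fst (x v : E) (t : R) :
  (fun z : E * E => (line z.1 z.2 t, z.2)) @ (x, v) --> (line x v t, v).
Proof.
have c : (fun z : E * E => line z.1 z.2 t) @ (x, v) --> line x v t.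
  by apply: cvg_line; [exact: cvg_fst|exact: cvg_snd|exact: cvg_cst].
by apply: (cvg_pair c); exact: cvg_snd.
Qed.

(** Difference quotients of the [n]-th derivative with a fixed step are continuous by induction, and
    by Taylor they approximate the next derivative with an error uniform near [(x, v)]. *)
Lemma dir_derive_cvg n (x v : E) : U x ->
  (fun z : E * E => dir_derive f n z.1 z.2) @ (x, v) --> dir_derive f n x v.
Proof.
elim: n x => [|n IH] x Ux.
  rewrite dir_derive0; under eq_fun do rewrite dir_derive0.
  exact: (cvg_comp _ _ cvg_fst (arc_smooth_continuous hE hF gp gq oU fU Ux)).
apply/(cvg_seminorm gq) => i e e0.
have [C [[A B] [/= xA B0] AB]] := near_taylor2 hE hF gp gq oU fU n i v Ux.
have UL : nbhs (0 : R^o) (line x v @^-1` U).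
  apply: open_nbhs_nbhs; split; last by rewrite /= line0.
  exact/(open_curve_preimage hE oU)/smooth_line.
(* Two remainders [C * t ^+ 2] and two increments below [e * t / 4] must add up to less than
   [e * t]. *)
have [t [t0 [Bt Ut] Ct]] := near0_pos (4 * C) (filterI B0 UL) e0.
have et : 0 < e * t / 4 by rewrite divr_gt0 // mulr_gt0.
have n1 : \forall z \near (x, v), q i (dir_derive f n (line z.1 z.2 t) z.2
    - dir_derive f n (line x v t) v) < e * t / 4.
  exact: (@cvg_line_fst x v t _ ((cvg_seminorm gq _ _).1 (IH _ Ut) i _ et)).
have n2 : \forall z \near (x, v), q i (dir_derive f n z.1 z.2 - dir_derive f n x v) < e * t / 4.
  exact: ((cvg_seminorm gq _ _).1 (IH _ Ux) i _ et).
have xA' : \forall z \near (x, v), A z by exact: xA.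
apply: filterS3 xA' n1 n2 => -[y u] /= Ayu h1 h2.
have h3 := AB ((y, u), t) (conj Ayu Bt).
have h4 := AB ((x, v), t) (conj (nbhs_singleton xA) Bt).
rewrite /= (gtr0_norm t0) in h3 h4.
set D1 := dir_derive f n.+1 y u in h3 *; set D2 := dir_derive f n.+1 x v in h4 *.
set a := dir_derive f n _ u in h1 h3; set b := dir_derive f n y u in h2 h3.
set c := dir_derive f n _ v in h1 h4; set d := dir_derive f n x v in h2 h4.
have qs := gq.1 i.
have h : q i (t *: (D1 - D2)) < t * e.
  have -> : t *: (D1 - D2) = (c - d - t *: D2) + - (a - b - t *: D1) + (a - c) + - (b - d).
    by lin R F.
  apply: le_lt_trans (seminormD4 i _ _ _ _) _; rewrite !(seminormN qs).
  by nra.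
by move: h; rewrite qs.2 (gtr0_norm t0) ltr_pM2l.
Qed.

Lemma strict_derive i (x v : E) (e : R) : U x -> 0 < e ->
  \forall w \near ((x, v), (0 : R^o)),
    q i (f (line w.1.1 w.1.2 w.2) - f w.1.1 - w.2 *: dir_derive f 1 x v) <= e * `|w.2|.
Proof.
move=> Ux e0; have e20 : 0 < e / 2 by rewrite divr_gt0.
have [C hC] := near_taylor2 hE hF gp gq oU fU 0 i v Ux.
have n1 : \forall z \near (x, v), q i (dir_derive f 1 z.1 z.2 - dir_derive f 1 x v) < e / 2.
  exact: ((cvg_seminorm gq _ _).1 (@dir_derive_cvg 1 x v Ux) i _ e20).
have n2 : \forall w \near ((x, v), (0 : R^o)), q i (dir_derive f 1 w.1.1 w.1.2 - dir_derive f
  1 x v) < e / 2.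
  exact: (@cvg_fst _ _ (nbhs (x, v)) (nbhs (0 : R^o)) _ _ n1).
have n3 : \forall w \near ((x, v), (0 : R^o)), `|w.2| * (`|C| + 1) < e / 2.
  suff n3 : \forall t \near (0 : R^o), `|t| * (`|C| + 1) < e / 2.
    exact: (@cvg_snd _ _ (nbhs (x, v)) (nbhs (0 : R^o)) _ _ n3).
  near=> t; rewrite -ltr_pdivlMr ?ltr_wpDl // -[t]subr0 distrC; near: t.
  apply: (@cvgr_dist_lt _ _ _ (nbhs (0 : R^o)) _ id); first exact: cvg_id.
  by rewrite divr_gt0 // ltr_wpDl.
apply: filterS3 hC n2 n3 => -[[y u] t] /= h1 h2 h3.
rewrite !dir_derive0 in h1; have qs := gq.1 i.
rewrite (_ : _ - _ - _ = (f (line y u t) - f y - t *: dir_derive f 1 y u)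
     + t *: (dir_derive f 1 y u - dir_derive f 1 x v)); last by lin R F.
apply: le_trans (qs.1 _ _) _; rewrite qs.2.
have h4 : C * `|t| ^+ 2 <= `|t| * (e / 2).
  rewrite expr2 mulrA mulrC ler_wpM2l // (le_trans _ (ltW h3)) // mulrC ler_wpM2l //.
  by rewrite (le_trans (ler_norm _)) // lerDl.
have h5 := ler_wpM2l (normr_ge0 t) (ltW h2).
lra.
Unshelve. all: by end_near. Qed.

Lemma strict_derive_cvg {T : Type} {G : set_system T} {FG : Filter G}
    (y u : T -> E) (r : T -> R^o) (x v : E) : U x ->
  y @ G --> x -> u @ G --> v -> r @ G --> (0 : R^o) ->
  (\forall w \near G, r w != 0) ->
  (fun w => (r w)^-1 *: (f (line (y w) (u w) (r w)) - f (y w))) @ G --> dir_derive f 1 x v.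
Proof.
move=> Ux yx uv r0 rn0; apply/(cvg_seminorm gq) => i e e0.
have e20 : 0 < e / 2 by rewrite divr_gt0.
have c : (fun w => ((y w, u w), r w)) @ G --> ((x, v), (0 : R^o)).
  exact: (cvg_pair (cvg_pair yx uv) r0).
have n1 : \forall w \near G, q i (f (line (y w) (u w) (r w)) - f (y w)
    - r w *: dir_derive f 1 x v) <= e / 2 * `|r w|.
  exact: (c _ (strict_derive i v Ux e20)).
apply: filterS2 n1 rn0 => w /= h rw0; have qs := gq.1 i.
have r0' : 0 < `|r w| by rewrite normr_gt0.
rewrite (_ : _ - _ = (r w)^-1 *:
    (f (line (y w) (u w) (r w)) - f (y w) - r w *: dir_derive f 1 x v)); last first.
  by rewrite [in RHS]scalerBr scalerA mulVf // scale1r.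
rewrite qs.2 normfV mulrC ltr_pdivrMr //; apply: le_lt_trans h _.
by rewrite ltr_pM2r // ltr_pdivrMr // ltr_pMr // ltr1n.
Qed.

Lemma cvg_dnbhs0 : (fun r : R^o => r) @ (0 : R^o)^' --> (0 : R^o).
Proof. exact: cvg_within. Qed.

(** The step along [u + v] is a step along [u] from [x] followed by one along [v] from the moving
    point [x + r u]; the strict derivative allows the latter. *)
Lemma dir_deriveD (x u v : E) : U x ->
  dir_derive f 1 x (u + v) = dir_derive f 1 x u + dir_derive f 1 x v.
Proof.
move=> Ux; have rn0 : \forall r \near (0 : R^o)^', r != 0 by exact: nbhs_dnbhs_neq.
have line_cvg : (fun r : R^o => line x u r) @ (0 : R^o)^' --> x.
  have : (fun r : R^o => line x u r) @ (0 : R^o)^' --> line x u 0.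
    by apply: cvg_line; [exact: cvg_cst|exact: cvg_cst|exact: cvg_dnbhs0].
  by rewrite line0.
have quot (y : R^o -> E) (w : E) : y @ (0 : R^o)^' --> x ->
    (fun r => r^-1 *: (f (line (y r) w r) - f (y r))) @ (0 : R^o)^' --> dir_derive f 1 x w.
  by move=> yx; apply: strict_derive_cvg => //; [exact: cvg_cst|exact: cvg_dnbhs0].
have xx : cst x @ (0 : R^o)^' --> x by exact: cvg_cst.
have c3 := quot (cst x) (u + v) xx.
suff c12 : (fun r : R^o => r^-1 *: (f (line x (u + v) r) - f x)) @ (0 : R^o)^' -->
    dir_derive f 1 x u + dir_derive f 1 x v by exact: (cvg_unique hF c3 c12).
apply: cvg_trans (tvs_cvgD (quot _ u xx) (quot _ v line_cvg)); apply: near_eq_cvg.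
apply: nearW => r /=; rewrite -scalerDr; congr (_ *: _).
rewrite [LHS]addrC addrA subrK; congr (f _ - _).
by rewrite /line scalerDr addrA.
Qed.

Lemma dir_deriveZ (n : nat) (x u : E) (a : R) : U x ->
  dir_derive f n x (a *: u) = a ^+ n *: dir_derive f n x u.
Proof.
move=> Ux; have oL := open_curve_preimage hE oU (smooth_line hE x u).
have := @iter_cderive_affine _ _ hF n _ (f \o line x u) a 0 0 oL.
rewrite subrr mulr0 /= line0 => /(_ _ Ux) <-; last exact: smooth_f_line.
congr (iter n curve_derive _ 0); apply/funext => s.
by rewrite /= /line subr0 scalerA mulrC.
Qed.

(** The polarization identity for the second derivative, with the factor [1/4] absorbed in the
    halved directions. *)
Definition mixed_derive (x u v : E) : F :=
  dir_derive f 2 x (2^-1 *: (u + v)) - dir_derive f 2 x (2^-1 *: (u - v)).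

Lemma mixed_derive_sym (x u v : E) : U x -> mixed_derive x u v = mixed_derive x v u.
Proof.
move=> Ux; rewrite /mixed_derive [v + u]addrC; congr (_ - _).
have -> : 2^-1 *: (v - u) = (-1 : R) *: (2^-1 *: (u - v)) by lin R E.
by rewrite dir_deriveZ // sqrrN expr1n scale1r.
Qed.

Lemma seminorm_addW i (a b : F) (A B : R) :
  q i a <= A -> q i b <= B -> q i (a + b) <= A + B.
Proof. by move=> aA bB; apply: le_trans ((gq.1 i).1 _ _) _; exact: lerD. Qed.

Lemma seminorm_oppW i (a : F) (A : R) : q i a <= A -> q i (- a) <= A.
Proof. by rewrite (seminormN (gq.1 i)). Qed.

Lemma seminorm_scaleW i (k : R) (a : F) (A : R) :
  q i a <= A -> q i (k *: a) <= `|k| * A.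
Proof. by rewrite (gq.1 i).2 => aA; exact: ler_wpM2l. Qed.

Section MixedStrict.
Variables (i : nat) (x u v : E).
Hypothesis Ux : U x.

Let cvg_line2 (g : E) : (fun w : E * R^o => line w.1 g w.2) @ (x, (0 : R^o)) --> x.
Proof.
have : (fun w : E * R^o => line w.1 g w.2) @ (x, (0 : R^o)) --> line x g 0.
  by apply: cvg_line; [exact: cvg_fst|exact: cvg_cst|exact: cvg_snd].
by rewrite line0.
Qed.

Let near_d2 (Y : E * R^o -> E) (h : E) (e : R) :
  Y @ (x, (0 : R^o)) --> x -> 0 < e ->
  \forall w \near (x, (0 : R^o)), q i (dir_derive f 2 (Y w) h - dir_derive f 2 x h) <= e.
Proof.
move=> Yx e0.
have c : (fun w => (Y w, h)) @ (x, (0 : R^o)) --> (x, h).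
  by apply: (cvg_pair Yx); exact: cvg_cst.
have n1 : \forall z \near (x, h), q i (dir_derive f 2 z.1 z.2 - dir_derive f 2 x h) < e.
  exact: ((cvg_seminorm gq _ _).1 (@dir_derive_cvg 2 x h Ux) i _ e0).
have n2 : \forall w \near (x, (0 : R^o)), q i (dir_derive f 2 (Y w) h - dir_derive f 2 x h) < e.
  exact: (c _ n1).
by apply: filterS n2 => w /ltW.
Qed.

(** The sign [c] serves both directions from the centre of the parallelogram; it disappears from the
    second order term and from the error. *)
Let near_f3 (Y : E * R^o -> E) (h : E) (c : R) :
  Y @ (x, (0 : R^o)) --> x -> `|c| = 1 ->
  exists C : R, \forall w \near (x, (0 : R^o)),
    q i (f (line (Y w) h (c * w.2)) - f (Y w) - (c * w.2) *: dir_derive f 1 (Y w) h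
         - (w.2 ^+ 2 / 2) *: dir_derive f 2 (Y w) h) <= C * `|w.2| ^+ 3.
Proof.
move=> Yx c1; have [C hC] := near_taylor3 hE hF gp gq oU fU i h Ux; exists C.
have c2 : (fun w : E * R^o => c * w.2 : R^o) @ (x, (0 : R^o)) --> (0 : R^o).
  rewrite -[X in _ --> X](mulr0 c); apply: (@tvs_cvgZ _ _ _ _ R^o (cst c)); first exact:
    cvg_cst.
  exact: cvg_snd.
have c3 : (fun w => (Y w, h)) @ (x, (0 : R^o)) --> (x, h).
  by apply: (cvg_pair Yx); exact: cvg_cst.
have n2 : \forall w \near (x, (0 : R^o)),
    q i (f (line (Y w) h (c * w.2)) - f (Y w) - (c * w.2) *: dir_derive f 1 (Y w) h
         - ((c * w.2) ^+ 2 / 2) *: dir_derive f 2 (Y w) h) <= C * `|c * w.2| ^+ 3.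
  have c4 : (fun w => ((Y w, h), c * w.2 : R^o)) @ (x, (0 : R^o)) --> ((x, h), (0 : R^o)).
    exact: (cvg_pair c3 c2).
  exact: (c4 _ hC).
apply: filterS n2 => w; rewrite normrM c1 mul1r exprMn.
by rewrite -[c ^+ 2]real_normK ?num_real // c1 expr1n mul1r.
Qed.

(* Both [t *: (df(y + t u; v) - df(y; v))] and [t ^+ 2 *: mixed_derive] are compared with
   the second difference [f (y + t u + t v) - f (y + t u) - f (y + t v) + f y],
   computed along [v] in the first case and along the diagonals
   [(u + v) / 2], [(u - v) / 2] from the centre of the parallelogram in the second. *)
Lemma mixed_strict (e : R) : 0 < e ->
  \forall w \near (x, (0 : R^o)),
    q i (dir_derive f 1 (line w.1 u w.2) v - dir_derive f 1 w.1 v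
         - w.2 *: mixed_derive x u v) <= e * `|w.2|.
Proof.
move=> e0; pose h := 2^-1 *: (u + v); pose k := 2^-1 *: (u - v).
(* The second derivative errors carry total weight [1/2 + 1/2 + 1 + 1 = 3], so they use half of [e];
   the other half is for the cubic remainders. *)
have d0 : 0 < e / 6 by rewrite divr_gt0.
have cid : (fun w : E * R^o => w.1) @ (x, (0 : R^o)) --> x by exact: cvg_fst.
have n1 : `|1 : R| = 1 by rewrite normr1.
have nN1 : `|-1 : R| = 1 by rewrite normrN1.
have [C1 hC1] := near_f3 v (cvg_line2 u) n1.
have [C2 hC2] := near_f3 v cid n1.
have [C3 hC3] := near_f3 h (cvg_line2 h) n1.
have [C4 hC4] := near_f3 h (cvg_line2 h) nN1.
have [C5 hC5] := near_f3 k (cvg_line2 h) n1.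
have [C6 hC6] := near_f3 k (cvg_line2 h) nN1.
have hX1 := near_d2 v (cvg_line2 u) d0.
have hX2 := near_d2 v cid d0.
have hYh := near_d2 h (cvg_line2 h) d0.
have hYk := near_d2 k (cvg_line2 h) d0.
pose C := C1 + C2 + C3 + C4 + C5 + C6.
have hC : \forall w \near (x, (0 : R^o)), C * `|w.2| < e / 2.
  suff n3 : \forall t \near (0 : R^o), C * `|t| < e / 2.
    exact: (@cvg_snd _ _ (nbhs x) (nbhs (0 : R^o)) _ _ n3).
  near=> t; apply: le_lt_trans (_ : (`|C| + 1) * `|t| < _).
    by rewrite ler_wpM2r // (le_trans (ler_norm _)) // lerDl.
  rewrite mulrC -ltr_pdivlMr ?ltr_wpDl // -[t]subr0 distrC; near: t.
  apply: (@cvgr_dist_lt _ _ _ (nbhs (0 : R^o)) _ id); first exact: cvg_id.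
  by rewrite divr_gt0 // ?ltr_wpDl // divr_gt0.
move: hC; apply: filter_app.
move: hYk; apply: filter_app.
move: hYh; apply: filter_app.
move: hX2; apply: filter_app.
move: hX1; apply: filter_app.
move: hC6; apply: filter_app.
move: hC5; apply: filter_app.
move: hC4; apply: filter_app.
move: hC3; apply: filter_app.
move: hC2; apply: filter_app.
move: hC1; apply: filter_app.
near=> w.
rewrite !(mul1r, mulN1r); set y := w.1; set t := w.2; set z := line y h t.
(* The centre [z] plus or minus [t h] and [t k] gives the four corners of the parallelogram. *)
have -> : line z h t = line (line y u t) v t by rewrite /z /line /h; lin R E.
have -> : line z h (- t) = y by rewrite /z /line /h; lin R E.
have -> : line z k t = line y u t by rewrite /z /line /h /k; lin R E.
have -> : line z k (- t) = line y v t by rewrite /z /line /h /k; lin R E.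
rewrite /mixed_derive -/h -/k.
move=> H1 H2 H3 H4 H5 H6 HX1 HX2 HYh HYk HC; have qs := gq.1 i.
have [t0|t0] := eqVneq t 0.
  rewrite t0 line0 subrr scale0r subr0 (seminorm0 qs) normr0 mulr0 //.
have T0 : 0 < `|t| by rewrite normr_gt0.
have t2 : `|t ^+ 2| = `|t| ^+ 2 by rewrite normrX.
have t22 : `|t ^+ 2 / 2| = `|t| ^+ 2 / 2 by rewrite normrM t2 (@gtr0_norm _ 2^-1).
have S1 := seminorm_addW (seminorm_addW (seminorm_addW (seminorm_oppW H1) H2) H3) H4.
have S2 := seminorm_addW (seminorm_addW S1 (seminorm_oppW H5)) (seminorm_oppW H6).
have S3 := seminorm_addW (seminorm_scaleW (t ^+ 2 / 2) HX2) (seminorm_scaleW (t ^+ 2 / 2)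
  (seminorm_oppW HX1)).
have S4 := seminorm_addW (seminorm_scaleW (t ^+ 2) HYh) (seminorm_scaleW (t ^+ 2)
  (seminorm_oppW HYk)).
(* In the signed sum all values of [f] cancel, as do the first order terms along [h] and [k], each
   taken with steps [t] and [- t]; what remains is [t *: W]. *)
set W := (X in q i X <= e * _).
have := seminorm_addW S2 (seminorm_addW S3 S4).
rewrite [X in q i X <= _](_ : _ = t *: W); last by rewrite /W; lin R F.
rewrite qs.2 t2 t22 => {S1 S2 S3 S4 H1 H2 H3 H4 H5 H6} S.
rewrite -(ler_pM2l T0); apply: le_trans S _.
have : (C * `|t|) * `|t| ^+ 2 <= e / 2 * `|t| ^+ 2 by rewrite ler_wpM2r ?exprn_ge0 // ltW.
exact: cubic_bound.
Unshelve. all: by end_near. Qed.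
End MixedStrict.

End StrictDerivativeTheory.

(** * First variation *)

Section DirectionalDerivative.
Context {R : realType}.

Lemma eq_tvs_derive {E G F : tvsType R} (f : E -> F) (g : G -> F) a v b w :
  diff_quotient f a v = diff_quotient g b w -> tvs_derive f a v = tvs_derive g b w.
Proof. by rewrite /tvs_derive => ->. Qed.

Lemma dir_derive1 {E F : tvsType R} (f : E -> F) (x v : E) :
  dir_derive f 1 x v = tvs_derive f x v.
Proof.
apply: eq_tvs_derive; apply/funext => h; rewrite /diff_quotient /= addr0.
have e : h *: (1 : R^o) = h by exact: mulr1.
by rewrite e line0 /line [x + _]addrC.
Qed.

Lemma D1E {E : tvsType R} (L : E * E -> R^o) (g k y : E) :
  D1 L g k y = dir_derive L 1 (g, k) (y, 0).
Proof.
rewrite dir_derive1; apply: eq_tvs_derive; apply/funext => h.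
rewrite /diff_quotient /=; congr (_ *: (L _ - _)).
by rewrite -[RHS]/(h *: y + g, h *: 0 + k) scaler0 add0r.
Qed.

Lemma D2E {E : tvsType R} (L : E * E -> R^o) (g k y : E) :
  D2 L g k y = dir_derive L 1 (g, k) (0, y).
Proof.
rewrite dir_derive1; apply: eq_tvs_derive; apply/funext => h.
rewrite /diff_quotient /=; congr (_ *: (L _ - _)).
by rewrite -[RHS]/(h *: 0 + g, h *: y + k) scaler0 add0r.
Qed.

Lemma dir_derive_fst {F : tvsType R} (f : R^o * R^o -> F) (s t : R^o) :
  dir_derive f 1 (s, t) (1, 0) = curve_derive (fun r => f (r, t)) s.
Proof.
rewrite dir_derive1; apply: eq_tvs_derive; apply/funext => h.
rewrite /diff_quotient /=; congr (_ *: (f _ - _)).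
by rewrite -[LHS]/(h *: (1 : R^o) + s, h *: (0 : R^o) + t) scaler0 add0r.
Qed.

Lemma dir_derive_snd {F : tvsType R} (f : R^o * R^o -> F) (s t : R^o) :
  dir_derive f 1 (s, t) (0, 1) = curve_derive (fun r => f (s, r)) t.
Proof.
rewrite dir_derive1; apply: eq_tvs_derive; apply/funext => h.
rewrite /diff_quotient /=; congr (_ *: (f _ - _)).
by rewrite -[LHS]/(h *: (0 : R^o) + s, h *: (1 : R^o) + t) scaler0 add0r.
Qed.

End DirectionalDerivative.

Section MixedLimit.
Context {R : realType} {E F : tvsType R}.
Variables (p : nat -> E -> R) (q : nat -> F -> R).
Hypotheses (hE : hausdorff_space E) (hF : hausdorff_space F).
Hypotheses (gp : generating_seminorms p) (gq : generating_seminorms q).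
Variables (U : set E) (f : E -> F).
Hypotheses (oU : open U) (fU : arc_smooth U f).

Lemma mixed_strict_cvg {T : Type} {G : set_system T} {FG : Filter G}
    (y : T -> E) (r : T -> R^o) (x u v : E) : U x ->
  y @ G --> x -> r @ G --> (0 : R^o) -> (\forall w \near G, r w != 0) ->
  (fun w => (r w)^-1 *: (dir_derive f 1 (line (y w) u (r w)) v - dir_derive f 1 (y w) v))
    @ G --> mixed_derive f x u v.
Proof.
move=> Ux yx r0 rn0; apply/(cvg_seminorm gq) => i e e0.
have e20 : 0 < e / 2 by rewrite divr_gt0.
have c : (fun w => (y w, r w)) @ G --> (x, (0 : R^o)) by exact: (cvg_pair yx r0).
have n1 : \forall w \near G, q i (dir_derive f 1 (line (y w) u (r w)) v
    - dir_derive f 1 (y w) v - r w *: mixed_derive f x u v) <= e / 2 * `|r w|.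
  exact: (c _ (mixed_strict hE hF gp gq oU fU i u v Ux e20)).
apply: filterS2 n1 rn0 => w /= h rw0; have qs := gq.1 i.
have r0' : 0 < `|r w| by rewrite normr_gt0.
set D := dir_derive f 1 _ v - _ in h *.
have -> : (r w)^-1 *: D - mixed_derive f x u v = (r w)^-1 *: (D - r w *: mixed_derive f x u v).
  by rewrite [in RHS]scalerBr scalerA mulVf // scale1r.
rewrite qs.2 normfV mulrC ltr_pdivrMr //; apply: le_lt_trans h _.
by rewrite ltr_pM2r // ltr_pdivrMr // ltr_pMr // ltr1n.
Qed.

Lemma mixed_derive_cvg (x u v : E) : U x ->
  (fun y => mixed_derive f y u v) @ x --> mixed_derive f x u v.
Proof.
move=> Ux; have c (w : E) : (fun y => dir_derive f 2 y w) @ x --> dir_derive f 2 x w.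
  have c1 : (fun y => (y, w)) @ x --> (x, w).
    by apply: (cvg_pair (@cvg_id _ (nbhs x))); exact: cvg_cst.
  exact: (cvg_comp _ _ c1 (@dir_derive_cvg _ _ _ _ _ hE hF gp gq _ _ oU fU 2 _ w Ux)).
exact: tvs_cvgB.
Qed.

End MixedLimit.

Lemma open_setX {T1 T2 : topologicalType} (A : set T1) (B : set T2) :
  open A -> open B -> open (A `*` B).
Proof.
move=> oA oB; rewrite openE => -[x y] /= [Ax By]; exists (A, B) => //=.
by split; exact: open_nbhs_nbhs.
Qed.

Section FirstVariation.
Context {R : realType} {E : tvsType R} (p : nat -> E -> R).
Hypotheses (hE : hausdorff_space E) (gp : generating_seminorms p).
Variables (N : set E) (I : set R^o) (L : E * E -> R^o) (cs : R^o * R^o -> E).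
Hypotheses (oN : open N) (oI : open I).
Hypotheses (sL : arc_smooth (N `*` setT) L) (scs : arc_smooth (setT `*` I) cs).
Hypothesis csN : forall s t, I t -> N (cs (s, t)).
Implicit Types s t : R^o.

Let hR := @haus_real R.
Let hRR := haus_prod hR hR.
Let hEE := haus_prod hE hE.
Let gR := @generating_real R.
Let gRR := generating_prod gR gR.
Let gEE := generating_prod gp gp.
Let oNT : open (N `*` [set: E]) := open_setX oN (@openT E).
Let oTI : open ([set: R^o] `*` I) := open_setX (@openT R^o) oI.
Let ITI s t : I t -> ([set: R^o] `*` I) (s, t). Proof. by move=> It; split. Qed.

(** The lift of the variation to the tangent bundle. The time derivative is taken as a directional
    derivative of [cs], so that its joint continuity in both variables is available. *)
Definition vlift (z : R^o * R^o) : E * E := (cs z, dir_derive cs 1 z (0, 1)).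
Definition vfield t : E := dir_derive cs 1 (0, t) (1, 0).
Definition dvfield t : E := mixed_derive cs (0, t) (1, 0) (0, 1).
Definition vdensity t : R^o := dir_derive L 1 (vlift (0, t)) (vfield t, dvfield t).

Lemma vlift_N s t : I t -> (N `*` [set: E]) (vlift (s, t)).
Proof. by move=> It; split => //; exact: csN. Qed.

Lemma dir_cvg n (v z : R^o * R^o) : I z.2 ->
  (fun y => dir_derive cs n y v) @ z --> dir_derive cs n z v.
Proof.
move=> Iz; have c : (fun y : R^o * R^o => (y, v)) @ z --> (z, v).
  have cv : (cst v : R^o * R^o -> R^o * R^o) @ z --> v by exact: cvg_cst.
  exact (cvg_pair (@cvg_id _ (nbhs z)) cv).
have Uz : ([set: R^o] `*` I) z by split.
have d := @dir_derive_cvg _ _ _ _ _ hRR hE gRR gp _ _ oTI scs n z v Uz.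
exact (cvg_comp _ _ c d).
Qed.

Lemma vlift_cvg z : I z.2 -> vlift @ z --> vlift z.
Proof.
move=> Iz; have Uz : ([set: R^o] `*` I) z by split.
have c := arc_smooth_continuous hRR hE gRR gp oTI scs Uz.
exact (cvg_pair c (@dir_cvg 1 (0, 1) z Iz)).
Qed.

Lemma cvg_time t : (fun r : R^o => ((0 : R^o), r)) @ t --> ((0 : R^o), t).
Proof.
have c0 : (cst 0 : R^o -> R^o) @ t --> (0 : R^o) by exact: cvg_cst.
exact (cvg_pair c0 (@cvg_id _ (nbhs t))).
Qed.

Lemma vfield_cvg t : I t -> vfield @ t --> vfield t.
Proof. by move=> It; exact (cvg_comp _ _ (@cvg_time t) (@dir_cvg 1 (1, 0) (0, t) It)). Qed.

Lemma dvfield_cvg t : I t -> dvfield @ t --> dvfield t.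
Proof.
move=> It.
exact (cvg_comp _ _ (@cvg_time t) (mixed_derive_cvg hRR hE gRR gp oTI scs (ITI 0 It))).
Qed.

Lemma dL_cvg {T : Type} {G : set_system T} {FG : Filter G} (y v : T -> E * E) x w :
  N x.1 -> y @ G --> x -> v @ G --> w ->
  (fun z => dir_derive L 1 (y z) (v z)) @ G --> dir_derive L 1 x w.
Proof.
move=> Nx yx vw; have Ux : (N `*` [set: E]) x by split.
exact (cvg_comp _ _ (cvg_pair yx vw) (@dir_derive_cvg _ _ _ _ _ hEE hR gEE gR _ _ oNT sL 1 x
  w Ux)).
Qed.

Lemma vdensity_cvg t : I t -> vdensity @ t --> vdensity t.
Proof.
move=> It; apply: dL_cvg; first exact: csN.
  exact (cvg_comp _ _ (@cvg_time t) (@vlift_cvg (0, t) It)).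
exact (cvg_pair (vfield_cvg It) (dvfield_cvg It)).
Qed.

(** The exchange of the derivatives in [s] and [t]: by symmetry, [dvfield] is both the time
    derivative of [vfield] and the rate of change in [s] of the velocities. *)
Lemma is_cderive_vfield t : I t -> is_cderive vfield t (dvfield t).
Proof.
move=> It; rewrite /dvfield (mixed_derive_sym hRR hE oTI scs) ?(ITI 0 It) //.
have c : (fun r : R^o => r^-1 *: (dir_derive cs 1 (line ((0 : R^o), t) ((0 : R^o), (1 : R^o))
  r) (1, 0)
    - dir_derive cs 1 (0, t) (1, 0))) @ (0 : R^o)^' --> mixed_derive cs (0, t) (0, 1) (1, 0).
  apply: (@mixed_strict_cvg _ _ _ _ _ hRR hE gRR gp _ _ oTI scs _ _ _ (cst (0, t)) id (0, t)).
  - exact: ITI.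
  - exact: cvg_cst.
  - exact: cvg_dnbhs0.
  - exact: nbhs_dnbhs_neq.
have lineE (r : R^o) : line ((0 : R^o), t) ((0 : R^o), (1 : R^o)) r = (0, r *: (1 : R^o) + t).
  by rewrite /line -[LHS]/(0 + r *: (0 : R^o), t + r *: (1 : R^o)) scaler0 addr0 addrC.
by apply: cvg_trans c; apply: near_eq_cvg; apply: nearW => r; rewrite lineE.
Qed.

(** The limit is joint, [s] tending to [0] and [t] to [t0], which encodes local uniformity in time.
    The quotients of [vlift] converge jointly and serve as varying directions in the strict
    derivative of [L]. *)
Lemma variation_cvg t0 : I t0 ->
  (fun z : R^o * R^o => z.1^-1 *: (L (vlift z) - L (vlift (0, z.2))))
    @ filter_prod (0 : R^o)^' (nbhs t0) --> vdensity t0.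
Proof.
move=> It0; set G := filter_prod _ _.
have c1 : (fun z : R^o * R^o => z.1) @ G --> (0 : R^o).
  exact (cvg_comp _ _ cvg_fst (@cvg_dnbhs0 R)).
have c2 : (fun z : R^o * R^o => z.2) @ G --> t0 by exact: cvg_snd.
have c3 : (fun z : R^o * R^o => ((0 : R^o), z.2)) @ G --> ((0 : R^o), t0).
  have c0 : (cst 0 : R^o * R^o -> R^o) @ G --> (0 : R^o) by exact: cvg_cst.
  exact (cvg_pair c0 c2).
have n0 : \forall z \near G, z.1 != 0.
  have h : \forall r \near (0 : R^o)^', r != 0 by exact: nbhs_dnbhs_neq.
  exact (@cvg_fst _ _ (0 : R^o)^' (nbhs t0) _ _ h).
have lineE (z : R^o * R^o) : line ((0 : R^o), z.2) ((1 : R^o), (0 : R^o)) z.1 = z.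
  rewrite /line -[LHS]/(0 + z.1 *: (1 : R^o), z.2 + z.1 *: (0 : R^o)) scaler0 addr0 add0r.
  by rewrite -[z.1 *: 1]/(z.1 * 1) mulr1 -surjective_pairing.
have c4 : (fun z : R^o * R^o => z.1^-1 *: (cs z - cs (0, z.2))) @ G --> vfield t0.
  have c : (fun z : R^o * R^o => z.1^-1 *: (cs (line ((0 : R^o), z.2) ((1 : R^o), (0 : R^o))
    z.1) - cs (0, z.2)))
      @ G --> vfield t0.
    apply: (@strict_derive_cvg _ _ _ _ _ hRR hE gRR gp _ _ oTI scs _ _ _
      (fun z => (0, z.2)) (cst (1, 0)) (fun z => z.1) (0, t0)) => //.
    exact: cvg_cst.
  apply: cvg_trans c; apply: near_eq_cvg; apply: nearW => z; by rewrite lineE.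
have c5 : (fun z : R^o * R^o => z.1^-1 *: (dir_derive cs 1 z (0, 1) - dir_derive cs 1 (0,
  z.2) (0, 1)))
    @ G --> dvfield t0.
  have c : (fun z : R^o * R^o => z.1^-1 *: (dir_derive cs 1 (line ((0 : R^o), z.2) ((1 :
    R^o), (0 : R^o)) z.1) (0, 1)
      - dir_derive cs 1 (0, z.2) (0, 1))) @ G --> dvfield t0.
    apply: (@mixed_strict_cvg _ _ _ _ _ hRR hE gRR gp _ _ oTI scs _ _ _
      (fun z => (0, z.2)) (fun z => z.1) (0, t0)) => //.
  apply: cvg_trans c; apply: near_eq_cvg; apply: nearW => z; by rewrite lineE.
have c6 : (fun z : R^o * R^o => z.1^-1 *: (vlift z - vlift (0, z.2))) @ G --> (vfield t0,
  dvfield t0).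
  exact (cvg_pair c4 c5).
have c7 : (fun z : R^o * R^o => vlift (0, z.2)) @ G --> vlift (0, t0).
  exact (cvg_comp _ _ c3 (@vlift_cvg (0, t0) It0)).
have c8 : (fun z : R^o * R^o => z.1^-1 *: (L (line (vlift (0, z.2))
    (z.1^-1 *: (vlift z - vlift (0, z.2))) z.1) - L (vlift (0, z.2)))) @ G --> vdensity t0.
  by apply: (@strict_derive_cvg _ _ _ _ _ hEE hR gEE gR _ _ oNT sL) => //; exact: vlift_N.
apply: cvg_trans c8; apply: near_eq_cvg; near=> z.
have z0 : z.1 != 0 by near: z.
have -> : line (vlift (0, z.2)) (z.1^-1 *: (vlift z - vlift (0, z.2))) z.1 = vlift z.
  by rewrite /line scalerA divff // scale1r addrC subrK.
by [].
Unshelve. all: by end_near.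
Qed.

Lemma variation_uniform (K : set R^o) (e : R) : compact K -> K `<=` I -> 0 < e ->
  \forall s \near (0 : R^o)^', forall t, K t ->
    `|s^-1 * (L (vlift (s, t)) - L (vlift (0, t))) - vdensity t| <= e.
Proof.
move=> cK KI e0; have e20 : 0 < e / 2 by rewrite divr_gt0.
have := (compact_near_coveringP K).1 cK _ ((0 : R^o)^')
  (fun s t => `|s^-1 * (L (vlift (s, t)) - L (vlift (0, t))) - vdensity t| <= e) _.
apply=> t0 Kt0; have It0 := KI _ Kt0.
have [[A B] [/= A0 Bt0] AB] := (cvg_seminorm gR _ _).1 (variation_cvg It0) 0%N _ e20.
have dt : \forall t \near t0, `|vdensity t - vdensity t0| < e / 2.
  exact: ((cvg_seminorm gR _ _).1 (vdensity_cvg It0) 0%N _ e20).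
exists (B `&` [set t | `|vdensity t - vdensity t0| < e / 2], A) => /=.
  by split => //; exact: filterI.
move=> [t s] /= [[Bt dtt] As]; have := AB (s, t) (conj As Bt) => /= h.
set x := s^-1 *: _ in h; rewrite -[X in `|X - _|]/(x).
have -> : x - vdensity t = (x - vdensity t0) - (vdensity t - vdensity t0).
  by rewrite opprB addrA subrK.
apply: le_trans (ler_normB _ _) _; rewrite [e](splitr e).
exact: (lerD (ltW h) (ltW dtt)).
Qed.

End FirstVariation.

(** * Differentiation of the action under the integral sign *)

Section IntegralLemmas.
Context {R : realType}.
Let mu := @lebesgue_measure R.

Lemma integrable_relcompact (I J : set R) (f : R -> R) :
  open J -> compact (closure J) -> closure J `<=` I ->
  (forall t, I t -> {for t, continuous f}) -> mu.-integrable J (EFin \o f).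
Proof.
move=> oJ cJ JI fc.
apply: (@integrableS _ _ _ mu (closure J)).
- exact: compact_measurable.
- exact: open_measurable.
- exact: subset_closure.
- apply: continuous_compact_integrable => //.
  by apply: continuous_in_subspaceT => t; rewrite inE => /JI; exact: fc.
Qed.

End IntegralLemmas.

Section ActionDerivative.
Context {R : realType} {E : tvsType R} (p : nat -> E -> R).
Hypotheses (hE : hausdorff_space E) (gp : generating_seminorms p).
Variables (N : set E) (I : set R^o) (L : E * E -> R^o) (cs : R^o * R^o -> E).
Hypotheses (oN : open N) (oI : open I).
Hypotheses (sL : arc_smooth (N `*` setT) L) (scs : arc_smooth (setT `*` I) cs).
Hypothesis csN : forall s t, I t -> N (cs (s, t)).
Let mu := @lebesgue_measure R.

Lemma lagrangian_action_vlift (J : set R) (s : R) :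
  lagrangian_action L J (fun t => cs (s, t)) = \int[mu]_(t in J) L (vlift cs (s, t)).
Proof.
rewrite /lagrangian_action; congr Rintegral; apply/funext => t.
by rewrite /vlift dir_derive_snd.
Qed.

Lemma L_vlift_continuous (s t : R) : I t -> {for t, continuous (fun t : R => L (vlift cs (s,
  t)) : R)}.
Proof.
move=> It; have c : (fun r : R^o => ((s : R^o), r)) @ (t : R^o) --> ((s : R^o), (t : R^o)).
  have c0 : (cst s : R^o -> R^o) @ (t : R^o) --> (s : R^o) by exact: cvg_cst.
  exact (cvg_pair c0 (@cvg_id _ (nbhs (t : R^o)))).
have c1 : (fun r : R^o => vlift cs (s, r)) @ (t : R^o) --> vlift cs (s, t).
  exact (cvg_comp _ _ c (@vlift_cvg _ _ _ hE gp _ _ oI scs (s, t) It)).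
have Ux : (N `*` [set: E]) (vlift cs (s, t)) by split => //; exact: csN.
exact (cvg_comp _ _ c1 (arc_smooth_continuous (haus_prod hE hE) (@haus_real R)
  (generating_prod gp gp) (@generating_real R) (open_setX oN (@openT E)) sL Ux)).
Qed.

(** The difference quotients of the integrand converge uniformly on the compact closure of [J],
    which has finite measure. *)
Lemma action_derive (J : set R) : open J -> compact (closure J) -> closure J `<=` I ->
  is_derive (0 : R^o) (1 : R^o) (fun s : R^o => lagrangian_action L J (fun t => cs (s, t)) :
    R^o)
    (\int[mu]_(t in J) vdensity L cs t).
Proof.
move=> oJ cJ JI; apply/is_cderive_is_derive.
have mJ : measurable (J : set (measurableTypeR R)) by exact: open_measurable.
have gc t : I t -> {for t, continuous (vdensity L cs : R -> R)}.
  by move=> It; exact: (vdensity_cvg hE gp oN oI sL scs csN It).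
have ig : mu.-integrable J (EFin \o (vdensity L cs : R -> R)).
  exact: integrable_relcompact JI gc.
have il (s : R) : mu.-integrable J (EFin \o (fun t : R => L (vlift cs (s, t)) : R)).
  by apply: integrable_relcompact JI _ => // t; exact: L_vlift_continuous.
have i1 (e : R) : mu.-integrable J (EFin \o (fun=> e : R)).
  by apply: integrable_relcompact JI _ => // t _; exact: cvg_cst.
have lc (s t : R) : I t -> {for t, continuous (fun t : R => L (vlift cs (s, t)) - L (vlift cs
  (0, t)) : R)}.
  by move=> It; apply: cvgB; exact: L_vlift_continuous.
have qc (s t : R) : I t -> {for t, continuous (fun t : R =>
    s^-1 * (L (vlift cs (s, t)) - L (vlift cs (0, t))) - vdensity L cs t : R)}.
  move=> It; apply: cvgB; last exact: gc.
  by apply: cvgM; [exact: cvg_cst|exact: lc].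
pose M : R := \int[mu]_(t in J) 1.
have M0 : 0 <= M by apply: Rintegral_ge0.
(* [M] is the length of [J]; it may be [0], hence the [1]. *)
apply/cvgrPdist_le => e e0; pose e' := e / (M + 1).
have e'0 : 0 < e' by rewrite divr_gt0 // ltr_wpDl.
have vu := variation_uniform hE gp oN oI sL scs csN cJ JI e'0.
apply: filterS vu => s hs.
rewrite /diff_quotient /= addr0; have -> : s *: (1 : R^o) = s by exact: mulr1.
rewrite !lagrangian_action_vlift -[_ *: _]/(_ * _) -RintegralB //.
rewrite -RintegralZl //; last exact: (integrable_relcompact oJ cJ JI (@lc s)).
rewrite distrC -RintegralB //; last first.
  apply: (integrable_relcompact oJ cJ JI) => t It.
  by apply: cvgM; [exact: cvg_cst|exact: lc].
pose phi (t : R) : R := s^-1 * (L (vlift cs (s, t)) - L (vlift cs (0, t))) - vdensity L cs t.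
suff : `|\int[mu]_(t in J) phi t| <= (e : R) by [].
have pc (t : R) : I t -> {for t, continuous phi} by exact: qc.
have ip : mu.-integrable J (EFin \o phi) by exact: (integrable_relcompact oJ cJ JI pc).
apply: le_trans (le_normr_Rintegral mJ ip) _.
apply: (@le_trans _ _ (\int[mu]_(t in J) e')).
  apply: le_Rintegral => //.
    apply: (integrable_relcompact oJ cJ JI) => t It.
    exact (cvg_comp _ _ (pc t It) (@norm_continuous _ R^o _)).
  by move=> t Jt; apply: hs; exact: subset_closure.
have -> : \int[mu]_(t in J) e' = e' * M.
  by rewrite -RintegralZl //; apply: eq_Rintegral => t _; rewrite mulr1.
by rewrite /e' mulrAC ler_pdivrMr ?ltr_wpDl // ler_wpM2l ?(ltW e0) // lerDl.
Qed.

End ActionDerivative.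

(** * The Euler-Lagrange equation *)

Section RealIntegrals.
Context {R : realType}.
Let mu := @lebesgue_measure R.

Lemma is_cderive_derive1 (f : R^o -> R^o) (t l : R^o) :
  is_cderive f t l <-> derivable f t 1 /\ f^`() t = l.
Proof.
split=> [/is_cderive_is_derive fl|[fd <-]]; last first.
  by apply/is_cderive_is_derive; rewrite derive1E; exact/derivableP.
by rewrite derive1E; case: fl.
Qed.

Lemma Rintegral_primitive (F f : R -> R) (a b : R) : a < b ->
  (forall t : R, a <= t <= b -> is_cderive (F : R^o -> R^o) t (f t)) ->
  (forall t : R, a <= t <= b -> {for t, continuous f}) ->
  \int[mu]_(t in `[a, b]) f t = F b - F a.
Proof.
move=> ab Ff fc; rewrite /Rintegral (@continuous_FTC2 _ f F) //.
- by apply: continuous_in_subspaceT => t; rewrite inE /= in_itv /=; exact: fc.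
- have Fc t : a <= t <= b -> {for t, continuous F}.
    by move=> /Ff/is_cderive_cvg.
  split.
  + move=> t; rewrite in_itv /= => /andP[at_ tb].
    by have /is_cderive_derive1[] : is_cderive (F : R^o -> R^o) t (f t) by apply: Ff; rewrite
      !ltW.
  + by apply: cvg_at_right_filter; apply: Fc; rewrite lexx ltW.
  + by apply: cvg_at_left_filter; apply: Fc; rewrite lexx ltW.
- move=> t; rewrite in_itv /= => /andP[at_ tb].
  by have /is_cderive_derive1[] : is_cderive (F : R^o -> R^o) t (f t) by apply: Ff; rewrite
    !ltW.
Qed.

Lemma Rintegral_support (J K : set R) (f : R -> R) : K `<=` J ->
  (forall t, J t -> ~ K t -> f t = 0) ->
  \int[mu]_(t in J) f t = \int[mu]_(t in K) f t.
Proof.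
move=> KJ f0; rewrite Rintegral_mkcond [RHS]Rintegral_mkcond; congr Rintegral.
apply/funext => t; rewrite /patch; case: ifPn => [|/negP] Jt; case: ifPn => [|/negP] Kt //.
  by apply: (f0 t (set_mem Jt)) => /mem_set.
by exfalso; apply: Jt; apply/mem_set/KJ/set_mem.
Qed.

(** The extreme points of [K] are pushed outwards inside the open set [I]; the interval property
    then puts everything between them in [I], which the fundamental theorem of calculus requires. *)
Lemma compact_in_open_interval (K I : set R) : open I -> is_interval I ->
  compact K -> K !=set0 -> K `<=` I ->
  exists a b : R, [/\ a < b, `[a, b]%classic `<=` I & K `<=` `]a, b[%classic].
Proof.
move=> oI iI cK K0 KI.
have [M KM maxM] : exists2 M, K M & forall t, K t -> t <= M.
  have [|M] := @compact_EVT_max _ R id K K0 cK; first by apply: continuous_subspaceT => x;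
    exact: cvg_id.
  by rewrite inE => KM hM; exists M => // t Kt; apply: hM; rewrite inE.
have [m Km minm] : exists2 m, K m & forall t, K t -> m <= t.
  have [|m] := @compact_EVT_max _ R (fun x => - x) K K0 cK.
    by apply: continuous_subspaceT => x; apply: cvgN; exact: cvg_id.
  by rewrite inE => Km hm; exists m => // t Kt; rewrite -lerN2; apply: hm; rewrite inE.
have /nbhs_ballP[d1 /= d10 Id1] : nbhs (M : R^o) I by apply: open_nbhs_nbhs; split => //;
  exact: KI.
have /nbhs_ballP[d2 /= d20 Id2] : nbhs (m : R^o) I by apply: open_nbhs_nbhs; split => //;
  exact: KI.
have mM := minm _ KM; have d12 : 0 < d1 / 2 by rewrite divr_gt0.
have d22 : 0 < d2 / 2 by rewrite divr_gt0.
exists (m - d2 / 2), (M + d1 / 2); split.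
- by lra.
- move=> t /=; rewrite in_itv /= => /andP[h1 h2].
  apply: (iI (m - d2 / 2) (M + d1 / 2)) => //; last by rewrite h1.
    by apply: Id2; rewrite -ball_normE /= opprB addrCA subrr addr0 gtr0_norm //; lra.
  by apply: Id1; rewrite -ball_normE /= opprD addrA subrr add0r normrN gtr0_norm //; lra.
- move=> t Kt /=; rewrite in_itv /=; have := minm _ Kt; have := maxM _ Kt.
  by move=> h1 h2; apply/andP; split; lra.
Qed.

End RealIntegrals.

Section EulerLagrangeEquation.
Context {R : realType} {E : tvsType R} (p : nat -> E -> R).
Hypotheses (hE : hausdorff_space E) (gp : generating_seminorms p).
Variables (N : set E) (I : set R^o) (L : E * E -> R^o) (c : R^o -> E).
Hypotheses (oN : open N) (oI : open I) (intI : is_interval I).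
Hypotheses (sL : arc_smooth (N `*` setT) L).
Hypotheses (smoothc : smooth_curve I c) (cN : forall t, I t -> N (c t)).
Implicit Types (t : R^o) (y : E).

Let hR := @haus_real R.
Let gR := @generating_real R.
Let hEE := haus_prod hE hE.
Let gEE := generating_prod gp gp.
Let oNT : open (N `*` [set: E]) := open_setX oN (@openT E).

Definition momentum y t : R^o := D2 L (c t) (curve_derive c t) y.
Definition force y t : R^o := D1 L (c t) (curve_derive c t) y.

Lemma jet_N t : I t -> (N `*` [set: E]) (c t, curve_derive c t).
Proof. by move=> It; split => //; exact: cN. Qed.

Lemma jet_cvg t : I t ->
  (fun r => (c r, curve_derive c r)) @ t --> (c t, curve_derive c t).
Proof.
move=> It; have c1 := smooth_continuous hE smoothc It.
exact (cvg_pair c1 (smooth_continuous hE (smooth_derive smoothc) It)).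
Qed.

Lemma dL_linear t (u v : E) : I t ->
  dir_derive L 1 (c t, curve_derive c t) (u, v) = force u t + momentum v t.
Proof.
move=> It; rewrite /force /momentum D1E D2E.
have -> : (u, v) = (u, 0) + (0, v) :> E * E by rewrite -[RHS]/(u + 0, 0 + v) addr0 add0r.
by apply: (dir_deriveD hEE hR gEE gR oNT sL); exact: jet_N.
Qed.

Lemma momentumZ a y t : I t -> momentum (a *: y) t = a * momentum y t.
Proof.
move=> It; rewrite /momentum !D2E.
have -> : (0, a *: y) = a *: ((0, y) : E * E) by rewrite -[RHS]/(a *: 0, a *: y) scaler0.
by rewrite (dir_deriveZ hEE hR oNT sL) ?expr1 //; exact: jet_N.
Qed.

Lemma forceZ a y t : I t -> force (a *: y) t = a * force y t.
Proof.
move=> It; rewrite /force !D1E.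
have -> : (a *: y, 0) = a *: ((y, 0) : E * E) by rewrite -[RHS]/(a *: y, a *: 0) scaler0.
by rewrite (dir_deriveZ hEE hR oNT sL) ?expr1 //; exact: jet_N.
Qed.

Lemma momentum0 t : I t -> momentum 0 t = 0.
Proof. by move=> It; rewrite -(scale0r (0 : E)) momentumZ // mul0r. Qed.

Lemma force0 t : I t -> force 0 t = 0.
Proof. by move=> It; rewrite -(scale0r (0 : E)) forceZ // mul0r. Qed.

Lemma momentumD y z t : I t -> momentum (y + z) t = momentum y t + momentum z t.
Proof.
move=> It; rewrite /momentum !D2E.
have -> : (0, y + z) = (0, y) + (0, z) :> E * E by rewrite -[RHS]/(0 + 0, y + z) addr0.
by apply: (dir_deriveD hEE hR gEE gR oNT sL); exact: jet_N.
Qed.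

Lemma momentum_quotient (w w0 : E) (h m0 : R^o) t : I t ->
  momentum (h^-1 *: (w - w0)) t + h^-1 *: (momentum w0 t - m0) =
  h^-1 *: (momentum w t - m0).
Proof.
move=> It; rewrite momentumZ // -scalerDr; congr (_ *: _).
by rewrite addrA -(momentumD _ _ It) subrK.
Qed.

(** A discrete Leibniz rule: linearity at time [h + t] separates the change of the vector from the
    change of time with the vector frozen at [w t]. *)
Lemma momentum_diff_quotient (w : R^o -> E) (h : R^o) t : I (h + t) ->
  momentum (diff_quotient w t 1 h) (h + t) + diff_quotient (momentum (w t)) t 1 h =
  diff_quotient (fun r => momentum (w r) r) t 1 h.
Proof.
move=> It; have e : h *: (1 : R^o) = h by exact: mulr1.
by rewrite /diff_quotient /= e; exact (momentum_quotient _ _ _ _ It).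
Qed.

Lemma force_cvg y t : I t -> force y @ t --> force y t.
Proof.
move=> It; rewrite /force D1E; under eq_fun do rewrite D1E.
have cy : (cst (y, 0) : R^o -> E * E) @ t --> ((y, 0) : E * E) by exact: cvg_cst.
exact (@dL_cvg _ _ _ hE gp _ _ oN sL _ _ _ _ _ (c t, curve_derive c t) _ (cN It) (jet_cvg It)
  cy).
Qed.

Section Variation.
Variables (cs : R^o * R^o -> E) (K : set R^o).
Hypothesis csK : compact_variation N I c cs K.

Lemma variation_arc_smooth : arc_smooth (setT `*` I) cs.
Proof. by case: csK => -[]. Qed.

Lemma variation_in_N s t : I t -> N (cs (s, t)).
Proof. by case: csK => -[h _] _ _ _ _ It; apply: h. Qed.

Let scs := variation_arc_smooth.
Let csN := variation_in_N.

Lemma vlift0 t : I t -> vlift cs (0, t) = (c t, curve_derive c t).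
Proof.
move=> It; case: csK => _ cs0 _ _ _; rewrite /vlift dir_derive_snd cs0 //.
congr (_, _); apply: (@iter_curve_derive_nearE _ _ 1).
by near=> r; apply: cs0; near: r; exact: open_nbhs_nbhs.
Unshelve. all: by end_near. Qed.

Lemma vfield_outside t : I t -> ~ K t -> vfield cs t = 0.
Proof.
move=> It Kt; case: csK => _ _ _ _ out; rewrite /vfield dir_derive_fst.
apply: (is_cderiveE hE); apply: (@is_cderive_near _ _ (cst (c t))).
  by near=> s; rewrite out.
exact: is_cderive_cst.
Unshelve. all: by end_near. Qed.

Lemma vdensityE t : I t ->
  vdensity L cs t = force (vfield cs t) t + momentum (dvfield cs t) t.
Proof. by move=> It; rewrite /vdensity vlift0 // dL_linear. Qed.

Lemma vdensity_outside t : I t -> ~ K t -> vdensity L cs t = 0.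
Proof.
move=> It Kt; have oIK : open (I `&` ~` K).
  apply: openI => //; apply: closed_openC; apply: compact_closed.
    exact: (@norm_hausdorff _ R^o).
  by case: csK.
have w0 : dvfield cs t = 0.
  rewrite -(is_cderiveE hE (is_cderive_vfield hE gp oI scs It)).
  apply: (is_cderiveE hE); apply: (@is_cderive_near _ _ (cst 0)); last exact: is_cderive_cst.
  near=> r; rewrite vfield_outside //.
    by have [] : (I `&` ~` K) r by near: r; exact: open_nbhs_nbhs.
  by have [] : (I `&` ~` K) r by near: r; exact: open_nbhs_nbhs.
rewrite vdensityE // w0 vfield_outside //.
by rewrite force0 // momentum0 // addr0.
Unshelve. all: by end_near. Qed.

(* The Euler-Lagrange equation turns the density of the first variation into a
   total derivative. *)
Lemma is_cderive_momentum_vfield t : I t ->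
  (forall y, is_cderive (momentum y) t (force y t)) ->
  is_cderive (fun r => momentum (vfield cs r) r) t (vdensity L cs t).
Proof.
move=> It EL; rewrite vdensityE // addrC.
have c1 := EL (vfield cs t).
have shift_cvg : (fun h : R^o => h + t) @ (0 : R^o)^' --> t.
  have : (fun h : R^o => h + t) @ (0 : R^o)^' --> 0 + t.
    by apply: tvs_cvgD; [exact: cvg_dnbhs0|exact: cvg_cst].
  by rewrite add0r.
have c2 : (fun h : R^o => momentum (diff_quotient (vfield cs) t 1 h) (h + t)) @ (0 : R^o)^' -->
    momentum (dvfield cs t) t.
  rewrite /momentum D2E; under eq_fun do rewrite D2E.
  have j : (fun h : R^o => (c (h + t), curve_derive c (h + t))) @ (0 : R^o)^' --> (c t,
    curve_derive c t).
    exact (cvg_comp _ _ shift_cvg (jet_cvg It)).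
  have w : (fun h : R^o => ((0 : E), diff_quotient (vfield cs) t 1 h)) @ (0 : R^o)^' --> ((0
    : E), dvfield cs t).
    have z : (cst 0 : R^o -> E) @ (0 : R^o)^' --> (0 : E) by exact: cvg_cst.
    exact (cvg_pair z (is_cderive_vfield hE gp oI scs It)).
  exact (@dL_cvg _ _ _ hE gp _ _ oN sL _ _ _ _ _ (c t, curve_derive c t) _ (cN It) j w).
have c12 : (fun h : R^o => momentum (diff_quotient (vfield cs) t 1 h) (h + t)
    + diff_quotient (momentum (vfield cs t)) t 1 h : R^o) @ (0 : R^o)^' -->
    momentum (dvfield cs t) t + force (vfield cs t) t by exact (tvs_cvgD c2 c1).
have nI : nbhs t I by exact: open_nbhs_nbhs.
have nIh : \forall h \near (0 : R^o)^', I (h + t) by exact: (shift_cvg _ nI).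
rewrite /is_cderive; apply: cvg_trans c12; apply: near_eq_cvg; near=> h.
have Ih : I (h + t) by near: h; exact: nIh.
exact (momentum_diff_quotient (vfield cs) Ih).
Unshelve. all: by end_near. Qed.

End Variation.

Lemma critical_of_EL :
  (forall t, I t -> forall y, is_cderive (momentum y) t (force y t)) -> critical N I L c.
Proof.
move=> EL cs K csK; have [_ _ cK KI _] := csK.
have scs := variation_arc_smooth csK; have csN := variation_in_N csK.
(* An empty support has no extreme points; [J] is then taken empty. *)
have [->|/set0P K0] := eqVneq K set0.
  exists set0; split => //.
  - by rewrite closure0; exact: compact0.
  - by rewrite closure0.
  - rewrite /lagrangian_action; under eq_fun do rewrite Rintegral_set0.
    exact: is_derive_cst.
have [a [b [ab abI Kab]]] := compact_in_open_interval oI intI cK K0 KI.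
have clab : closure `]a, b[%classic `<=` `[a, b]%classic.
  have e : `[a, b]%classic = closure `[a, b]%classic :> set R.
    by apply/closure_id; exact: itv_closed.
  by rewrite [X in _ `<=` X]e; apply: closure_subset; exact: subset_itv_oo_cc.
have cJ : compact (closure `]a, b[).
  by apply: (subclosed_compact _ (@segment_compact _ a b) clab); exact: closed_closure.
have JI : closure `]a, b[ `<=` I by exact: subset_trans abI.
have oJ : open (`]a, b[%classic : set R) by exact: interval_open.
exists `]a, b[%classic; split => //.
have := action_derive hE gp oN oI sL scs csN oJ cJ JI.
suff -> : \int[@lebesgue_measure R]_(t in `]a, b[) vdensity L cs t = 0 by apply.
have KJ : K `<=` `]a, b[%classic by [].
have out0 t : I t -> ~ K t -> vdensity L cs t = 0 by exact: (vdensity_outside csK).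
(* The integral passes through [K] to reach the closed interval; its endpoints lie outside [K], so
   the boundary terms vanish. *)
rewrite (Rintegral_support KJ); last first.
  by move=> t Jt; apply: out0; apply: JI; exact: subset_closure.
have Kcc : K `<=` `[a, b]%classic by apply: subset_trans KJ _; exact: subset_itv_oo_cc.
rewrite -(Rintegral_support Kcc); last by move=> t /abI; exact: out0.
have abI' t : a <= t <= b -> I t by move=> abt; apply: abI; rewrite /= in_itv.
rewrite (@Rintegral_primitive _ (fun r => momentum (vfield cs r) r) _ a b ab).
- have end0 t : I t -> ~ K t -> momentum (vfield cs t) t = 0.
    by move=> It Kt; rewrite (vfield_outside csK It Kt) momentum0.
  rewrite !end0 ?subrr //; do ?by apply: abI'; rewrite lexx ltW.
  + by move=> /Kab /=; rewrite in_itv /= ltxx.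
  + by move=> /Kab /=; rewrite in_itv /= ltxx andbF.
- by move=> t /abI' It; apply: (is_cderive_momentum_vfield csK It); exact: EL.
- by move=> t /abI' It; exact: (vdensity_cvg hE gp oN oI sL scs csN It).
Qed.

End EulerLagrangeEquation.

(** * Test functions and test variations *)

Section TestFunctions.
Context {R : realType}.
Let mu := @lebesgue_measure R.

Lemma integrable_segment (a b : R) (f : R -> R) :
  (forall t : R, a <= t <= b -> {for t, continuous f}) ->
  mu.-integrable `[a, b] (EFin \o f).
Proof.
move=> fc; apply: continuous_compact_integrable; first exact: segment_compact.
by apply: continuous_in_subspaceT => t; rewrite inE /= in_itv /=; exact: fc.
Qed.

(* The minorant is chosen for its positive integral over [[-1, 1]], namely [4 / 15]. *)
Lemma le_plateau (x : R) : `|x| <= 1 -> (1 - 4 * x ^+ 2) * (1 - x ^+ 2) <= plateau x.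
Proof.
move=> x1; have v1 : x ^+ 2 <= 1.
  by rewrite -[x ^+ 2]real_normK ?num_real // expr_le1.
have v0 := sqr_ge0 x.
have [x2|x2] := leP `|x| 2^-1.
  by rewrite plateau_eq1 //; move: (x ^+ 2) v0 v1 => v v0 v1; nra.
apply: le_trans (plateau_ge0 _).
have v2 : 4^-1 <= x ^+ 2.
  rewrite -[x ^+ 2]real_normK ?num_real // expr2.
  by move: `|x| x2 => u u2; nra.
by move: (x ^+ 2) v1 v2 => v v1 v2; nra.
Qed.

Lemma Rintegral_plateau_gt0 (t0 d : R) (e : R) (f : R -> R) : 0 < d -> 0 < e ->
  (forall t : R, t0 - d <= t <= t0 + d -> {for t, continuous f}) ->
  (forall t : R, t0 - d <= t <= t0 + d -> e * plateau (d^-1 * (t - t0)) <= f t) ->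
  0 < \int[mu]_(t in `[t0 - d, t0 + d]) f t.
Proof.
move=> d0 e0 fc ef; pose x (t : R) : R := d^-1 * (t - t0).
have ab : t0 - d < t0 + d by lra.
pose g (t : R) : R := e * ((1 - 4 * x t ^+ 2) * (1 - x t ^+ 2)).
(* A primitive of the minorant [1 - 5 x ^+ 2 + 4 x ^+ 4]; the factor [d] comes from the change of
   variable. *)
pose G (t : R) : R := e * d * (x t - 5 / 3 * x t ^+ 3 + 4 / 5 * x t ^+ 5).
have dn0 : d != 0 by rewrite gt_eqF.
have xd (t : R) : is_derive t (1 : R) x d^-1.
  apply/is_cderive_is_derive.
  have := is_cderiveZ (is_cderive_cst (d^-1 : R^o) t)
    (is_cderiveD (is_cderive_id t) (is_cderive_cst (- t0 : R^o) t)).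
  by rewrite scale0r add0r addr0 /GRing.scale /= mulr1.
have Gd (t : R) : is_derive t (1 : R) G (g t).
  rewrite /G; apply: is_derive_eq; rewrite /g /GRing.scale /=. field.
  exact: dn0.
have gc (t : R) : {for t, continuous g}.
  have xc : {for t, continuous x}.
    by apply: differentiable_continuous; apply/derivable1_diffP; case: (xd t).
  apply: cvgM; first exact: cvg_cst.
  apply: cvgM; apply: cvgB; first exact: cvg_cst.
  - by apply: cvgM; [exact: cvg_cst|apply: cvgM].
  - exact: cvg_cst.
  - exact: cvgM.
have := @Rintegral_primitive _ G g _ _ ab.
move=> /(_ (fun t _ => (is_cderive_is_derive _ _ _).2 (Gd t)) (fun t _ => gc t)) Ig.
apply: (@lt_le_trans _ _ (\int[mu]_(t in `[t0 - d, t0 + d]) g t)).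
  have xa : x (t0 - d) = -1 by rewrite /x; field.
  have xb : x (t0 + d) = 1 by rewrite /x; field.
  rewrite Ig /G xa xb (_ : _ - _ = e * d * (4 / 15)); last by field.
  by rewrite !mulr_gt0.
apply: le_Rintegral => //.
- by apply: integrable_segment => t _; exact: gc.
- exact: integrable_segment.
- move=> t; rewrite /= in_itv /= => tab; apply: le_trans (ef t tab).
  rewrite ler_pM2l //; apply: le_plateau.
  rewrite /x normrM gtr0_norm ?invr_gt0 // ler_pdivrMl // mulr1 ler_norml.
  by move: tab => /andP[h1 h2]; apply/andP; split; lra.
Qed.

End TestFunctions.

Section CriticalCurves.
Context {R : realType} {E : tvsType R} (p : nat -> E -> R).
Hypotheses (hE : hausdorff_space E) (gp : generating_seminorms p).
Variables (N : set E) (I : set R^o) (L : E * E -> R^o) (c : R^o -> E).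
Hypotheses (oN : open N) (oI : open I).
Hypotheses (sL : arc_smooth (N `*` setT) L).
Hypotheses (smoothc : smooth_curve I c) (cN : forall t, I t -> N (c t)).
Implicit Types (t : R^o) (y : E).

Let hR := @haus_real R.
Let gR := @generating_real R.
Let mu := @lebesgue_measure R.

Definition velocity_family y (z : R^o * R^o) : R^o :=
  L (c z.2, curve_derive c z.2 + z.1 *: y).

Lemma velocity_family_arc_smooth y : arc_smooth (setT `*` I) (velocity_family y).
Proof.
move=> g gs gI; have sg := smooth_fst hR hR openT gs; have tg := smooth_snd hR hR openT gs.
have gI2 t : setT t -> I (g t).2 by have [] := gI t.
pose h t : E * E := (c (g t).2, curve_derive c (g t).2 + (g t).1 *: y).
have hs : smooth_curve setT h.
  apply: (smooth_pair hE hE openT).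
    exact: (smooth_comp hE openT oI gI2 tg smoothc).
  apply: (smoothD hE openT).
    exact: (smooth_comp hE openT oI gI2 tg (smooth_derive smoothc)).
  by apply: (smoothZ hE openT sg); exact: smooth_cst.
by apply: (sL hs) => t; split => //; exact/cN/gI2.
Qed.

(** Viewed as a real-valued variation, [velocity_family] inherits the calculus of [vfield] and
    [dvfield], which gives the derivative of [momentum] and its continuity. *)
Lemma momentum_vfield y : momentum L c y = vfield (velocity_family y).
Proof.
apply/funext => t; rewrite /vfield dir_derive_fst.
apply: eq_tvs_derive; apply/funext => h; rewrite /diff_quotient /= /velocity_family /=.
have e : h *: (1 : R^o) = h by exact: mulr1.
by rewrite e addr0 scale0r addr0 [h *: y + _]addrC.
Qed.

Definition dmomentum y t : R^o := dvfield (velocity_family y) t.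

Lemma is_cderive_momentum y t : I t -> is_cderive (momentum L c y) t (dmomentum y t).
Proof.
move=> It; rewrite momentum_vfield.
exact: (is_cderive_vfield hR gR oI (@velocity_family_arc_smooth y) It).
Qed.

Lemma dmomentum_cvg y t : I t -> dmomentum y @ t --> dmomentum y t.
Proof. by move=> It; exact: (dvfield_cvg hR gR oI (@velocity_family_arc_smooth y) It). Qed.

Lemma momentum_C1 y : C1_on I (momentum L c y).
Proof.
split=> t It; first by have /is_cderive_derive1[] := @is_cderive_momentum y t It.
have e : \forall r \near t, dmomentum y r = (momentum L c y)^`() r.
  near=> r; have Ir : I r by near: r; exact: open_nbhs_nbhs.
  by have /is_cderive_derive1[_ ->] := @is_cderive_momentum y r Ir.
rewrite /prop_for /continuous_at -(nbhs_singleton e).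
apply: cvg_trans (@dmomentum_cvg y t It); exact: near_eq_cvg.
Unshelve. all: by end_near. Qed.

Section TestVariation.
Variables (y : E) (t0 d k : R).
Hypotheses (d0 : 0 < d) (k0 : 0 < k).
Let K : set R := `[t0 - d, t0 + d]%classic.
Hypothesis KI : K `<=` I.
Hypothesis kN : forall t r : R, K t -> `|r| <= k -> N (c t + r *: y).

Definition test (t : R^o) : R^o := plateau (d^-1 * (t - t0)).
(** A variation must stay in [N] for every real [s]. Cutting [s] off by [plateau] keeps the
    displacement within [k] times [y], and nothing changes for [s] near [0]. *)
Definition test_variation (z : R^o * R^o) : E :=
  c z.2 + ((z.1 * plateau z.1) * (k * test z.2)) *: y.

Lemma test_smooth A : smooth_curve A test.
Proof.
apply: (@sub_smooth_curve _ _ A setT) => //.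
have aff : smooth_curve setT (fun t : R^o => d^-1 * (t - t0) : R^o).
  apply: (@smoothZ _ R^o hR _ (cst (d^-1 : R^o))); first exact: openT.
    exact: smooth_cst.
  apply: (@smoothD _ R^o hR _ id); first exact: openT.
    exact: smooth_id.
  exact: smooth_cst.
exact (smooth_comp hR openT openT (fun _ _ => Logic.I) aff bump_plateau.1).
Qed.

Lemma test_out t : ~ K t -> test t = 0.
Proof.
move=> Kt; apply: plateau_eq0; rewrite normrM gtr0_norm ?invr_gt0 //.
rewrite ler_pdivlMl // mulr1 leNgt; apply/negP => h; apply: Kt.
by move: h; rewrite /K /= in_itv /= ltr_norml => /andP[h1 h2]; apply/andP; split; lra.
Qed.

Lemma test_ge0 t : 0 <= test t. Proof. exact: plateau_ge0. Qed.

Lemma test_le1 t : test t <= 1. Proof. exact: plateau_le1. Qed.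

Lemma test_end t : `|t - t0| = d -> test t = 0.
Proof.
move=> td; apply: plateau_eq0; rewrite normrM td gtr0_norm ?invr_gt0 //.
by rewrite mulVf // gt_eqF.
Qed.

Lemma test_variation_compact : compact_variation N I c test_variation K.
Proof.
split.
- split=> [[s t] [_ It]|g gs gI].
    rewrite /test_variation /=; have [Kt|Kt] := pselect (K t); last first.
      by rewrite test_out // !mulr0 scale0r addr0; exact: cN.
    apply: kN => //; rewrite normrM.
    apply: le_trans (_ : 1 * k <= _); last by rewrite mul1r.
    rewrite ler_pM ?normr_ge0 ?Xplateau_le1 // normrM (gtr0_norm k0).
    by rewrite (ger0_norm (test_ge0 _)) ler_piMr ?test_le1 // ltW.
  have sg := smooth_fst hR hR openT gs; have tg := smooth_snd hR hR openT gs.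
  have gI2 t : setT t -> I (g t).2 by have [] := gI t.
  apply: (smoothD hE openT).
    exact: (smooth_comp hE openT oI gI2 tg smoothc).
  apply: (smoothZ hE openT); last exact: smooth_cst.
  apply: (@smoothZ _ R^o hR); first exact: openT.
    exact (smooth_comp hR openT openT (fun _ _ => Logic.I) sg bump_Xplateau.1).
  apply: (@smoothZ _ R^o hR _ (cst k)); first exact: openT.
    exact: smooth_cst.
  exact (smooth_comp hR openT openT (fun _ _ => Logic.I) tg (@test_smooth setT)).
- by move=> t It; rewrite /test_variation /= !mul0r scale0r addr0.
- exact: segment_compact.
- exact: KI.
- by move=> s t It Kt; rewrite /test_variation /= test_out // !mulr0 scale0r addr0.
Qed.

Let cv := test_variation_compact.
Let scs := variation_arc_smooth cv.
Let csN := variation_in_N cv.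

Lemma vfield_test t : vfield test_variation t = (k * test t) *: y.
Proof.
rewrite /vfield dir_derive_fst; apply: (is_cderiveE hE).
apply: (@is_cderive_near _ _ (line (c t) ((k * test t) *: y))); last exact: is_cderive_line.
near=> s; rewrite /line /test_variation /= plateau_eq1 ?mulr1 ?scalerA //.
Unshelve. all: by end_near. Qed.

Lemma dvfield_test t : I t ->
  dvfield test_variation t = (k * curve_derive test t) *: y.
Proof.
move=> It; apply: (is_cderive_unique hE (is_cderive_vfield hE gp oI scs It)).
have -> : vfield test_variation = (fun r => (k * test r) *: y).
  by apply/funext => r; exact: vfield_test.
have dt := smooth_curve_cderive hR (@test_smooth setT) (Logic.I : setT t).
have := is_cderiveZ (is_cderiveZ (is_cderive_cst (k : R^o) t) dt) (is_cderive_cst y t).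
by rewrite scale0r add0r scaler0 addr0.
Qed.

Lemma vdensity_test t : I t -> vdensity L test_variation t =
  k * (test t * force L c y t + curve_derive test t * momentum L c y t).
Proof.
move=> It; rewrite (vdensityE hE gp oN oI sL cN cv It) vfield_test dvfield_test //.
rewrite (forceZ hE oN sL cN _ _ It) (momentumZ hE oN sL cN _ _ It).
by rewrite mulrDr !mulrA.
Qed.

End TestVariation.

End CriticalCurves.

Section Necessity.
Context {R : realType} {E : tvsType R} (p : nat -> E -> R).
Hypotheses (hE : hausdorff_space E) (gp : generating_seminorms p).
Variables (N : set E) (I : set R^o) (L : E * E -> R^o) (c : R^o -> E).
Hypotheses (oN : open N) (oI : open I).
Hypotheses (sL : arc_smooth (N `*` setT) L).
Hypotheses (smoothc : smooth_curve I c) (cN : forall t, I t -> N (c t)).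
Implicit Types (t : R^o) (y : E).

Let hR := @haus_real R.
Let mu := @lebesgue_measure R.

(** Compactness makes the admissible displacement along [y] uniform in time. *)
Lemma tube_in_N y (K : set R) : compact K -> K `<=` I ->
  exists2 k : R, 0 < k & forall t r : R, K t -> `|r| <= k -> N (c t + r *: y).
Proof.
move=> cK KI.
have near_N : \forall r \near (0 : R^o), K `<=` (fun t => N (c t + r *: y)).
  apply: ((compact_near_coveringP K).1 cK _ (nbhs (0 : R^o))
    (fun (r : R^o) (t : R) => N (c t + r *: y)) _) => t Kt.
  have It := KI _ Kt.
  have c1 : (fun z : R^o * R^o => c z.1 + z.2 *: y) @ ((t : R^o), (0 : R^o)) --> c t + (0 :
    R^o) *: y.
    apply: tvs_cvgD.
      exact (cvg_comp _ _ (@cvg_fst _ _ (nbhs (t : R^o)) (nbhs (0 : R^o)) _)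
        (smooth_continuous hE smoothc It)).
    have c2 : (fun z : R^o * R^o => z.2) @ ((t : R^o), (0 : R^o)) --> (0 : R^o) by exact:
      cvg_snd.
    have c3 : (cst y : R^o * R^o -> E) @ ((t : R^o), (0 : R^o)) --> y by exact: cvg_cst.
    exact (tvs_cvgZ c2 c3).
  rewrite scale0r addr0 in c1.
  exact: (c1 _ (open_nbhs_nbhs (conj oN (cN It)))).
have /nbhs_ballP[k' /= k'0 Nk'] := near_N.
exists (k' / 2); first by rewrite divr_gt0.
move=> t r Kt rk; apply: (Nk' r) => //.
by rewrite -ball_normE /= sub0r normrN; apply: le_lt_trans rk _; lra.
Qed.

Section Test.
Variables (y : E) (t0 d k : R).
Hypotheses (d0 : 0 < d) (k0 : 0 < k).
Let K : set R := `[t0 - d, t0 + d]%classic.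
Hypothesis KI : K `<=` I.
Hypothesis kN : forall t r : R, K t -> `|r| <= k -> N (c t + r *: y).
Hypothesis crit : critical N I L c.

Let cv := test_variation_compact hE oI smoothc cN d0 k0 KI kN.
Let scs := variation_arc_smooth cv.
Let csN := variation_in_N cv.
Let cs := test_variation c y t0 d k.
Let gap (t : R) : R := force L c y t - dmomentum L c y t.

(** Criticality provides some [J]; uniqueness of the derivative of the action makes the integral
    over [J] vanish, and the density is supported in [K]. *)
Lemma Rintegral_vdensity0 : \int[mu]_(t in K) vdensity L cs t = 0.
Proof.
have [J [oJ cJ JI KJ crit0]] := crit cv.
have := action_derive hE gp oN oI sL scs csN oJ cJ JI.
move=> [_]; have [_ ->] := crit0 => /esym.
rewrite (Rintegral_support KJ) // => t Jt; apply: (vdensity_outside hE gp oN oI sL cN cv).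
exact/JI/subset_closure.
Qed.

Lemma Rintegral_gap0 : \int[mu]_(t in K) (k * (test t0 d t * gap t)) = 0.
Proof.
have tI (t : R) : t0 - d <= t <= t0 + d -> I t by move=> tK; apply: KI; rewrite /K /= in_itv.
have tc (t : R) : {for t, continuous (test t0 d : R -> R)}.
  exact: (smooth_continuous hR (@test_smooth _ t0 d setT) Logic.I).
have dtc (t : R) : {for t, continuous (curve_derive (test t0 d) : R -> R)}.
  exact: (smooth_continuous hR (smooth_derive (@test_smooth _ t0 d setT)) Logic.I).
have mc (t : R) : I t -> {for t, continuous (momentum L c y : R -> R)}.
  by move=> It; exact (is_cderive_cvg (is_cderive_momentum hE oI sL smoothc cN (y := y) It)).
have dmc (t : R) : I t -> {for t, continuous (dmomentum L c y : R -> R)}.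
  by move=> It; exact (dmomentum_cvg hE oI sL smoothc cN (y := y) It).
pose H (t : R) : R := test t0 d t * momentum L c y t.
pose H' (t : R) : R := curve_derive (test t0 d) t * momentum L c y t
  + test t0 d t * dmomentum L c y t.
have Hd (t : R) : t0 - d <= t <= t0 + d -> is_cderive (H : R^o -> R^o) t (H' t).
  move=> /tI It.
  have dt := smooth_curve_cderive hR (@test_smooth _ t0 d setT) (Logic.I : setT (t : R^o)).
  exact: (is_cderiveZ dt (is_cderive_momentum hE oI sL smoothc cN (y := y) It)).
have Hc (t : R) : t0 - d <= t <= t0 + d -> {for t, continuous H'}.
  move=> /tI It; apply: cvgD; apply: cvgM.
  - exact: dtc.
  - exact: mc.
  - exact: tc.
  - exact: dmc.
have ab : t0 - d < t0 + d by rewrite ltrBlDr -addrA ltrDl addr_gt0.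
have IH : \int[mu]_(t in K) H' t = 0.
  have ea : test t0 d (t0 - d) = 0.
    by apply: test_end; rewrite // addrAC subrr add0r normrN gtr0_norm.
  have eb : test t0 d (t0 + d) = 0.
    by apply: test_end; rewrite // addrAC subrr add0r gtr0_norm.
  by rewrite (Rintegral_primitive ab Hd Hc) /H ea eb !mul0r subrr.
have vc (t : R) : t0 - d <= t <= t0 + d -> {for t, continuous (vdensity L cs : R -> R)}.
  by move=> /tI It; exact: (vdensity_cvg hE gp oN oI sL scs csN It).
have iv := integrable_segment vc.
have kHc (t : R) : t0 - d <= t <= t0 + d -> {for t, continuous (fun t => k * H' t)}.
  by move=> /Hc ?; apply: cvgM => //; exact: cvg_cst.
have mK : measurable (K : set (measurableTypeR R)) by exact: measurable_itv.
(* Integration by parts: subtracting [k * H'] from the density removes the term with [momentum] and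
   leaves the gap; [H] vanishes at both ends. *)
have := RintegralB mK iv (integrable_segment kHc).
rewrite Rintegral_vdensity0 RintegralZl //; last exact: integrable_segment.
rewrite IH mulr0 subrr => <-; apply: eq_Rintegral => t; rewrite inE => Kt.
rewrite (vdensity_test hE gp oN oI sL smoothc cN d0 k0 KI kN (KI Kt)) /H' /gap.
by ring.
Qed.

End Test.

Lemma EL_of_critical y t : critical N I L c -> I t ->
  dmomentum L c y t = force L c y t.
Proof.
move=> crit It; apply/eqP/negPn/negP => neq.
(* Multiplying by the constant [g t] makes the product positive near [t] whatever the sign of [g t];
   half its value at [t] is the lower bound [e]. *)
pose g (r : R) : R := force L c y r - dmomentum L c y r.
have g0 : g t != 0 by rewrite subr_eq0 eq_sym.
have gg : 0 < g t * g t by rewrite -expr2 exprn_even_gt0.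
have gc (r : R) : I r -> {for r, continuous g}.
  move=> Ir; apply: cvgB.
    exact (force_cvg hE gp oN sL smoothc cN (y := y) Ir).
  exact (dmomentum_cvg hE oI sL smoothc cN (y := y) Ir).
pose e := g t * g t / 2.
have e0 : 0 < e by rewrite divr_gt0.
have near_g : \forall r \near (t : R^o), I r /\ e < g t * g r.
  have gtc : (fun r : R => g t * g r) @ (t : R) --> g t * g t.
    by apply: cvgM; [exact: cvg_cst|exact: gc].
  apply: filterI; first exact: open_nbhs_nbhs.
  apply: (cvgr_gt _ gtc); rewrite /e; lra.
have /nbhs_ballP[d' /= d'0 hd] := near_g.
pose d : R := d' / 2; have d0 : 0 < d by rewrite divr_gt0.
pose K : set R := `[t - d, t + d]%classic.
have Kd (r : R) : t - d <= r <= t + d -> I r /\ e < g t * g r.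
  move=> /andP[h1 h2]; apply: hd; rewrite -ball_normE /= ltr_norml /d in h1 h2 *.
  by apply/andP; split; lra.
have KI : K `<=` I by move=> r; rewrite /K /= in_itv /= => /Kd[].
have [k k0 kN] := tube_in_N y (@segment_compact _ (t - d) (t + d)) KI.
have I0 := Rintegral_gap0 d0 k0 KI kN crit.
have tc (r : R) : {for r, continuous (test t d : R -> R)}.
  exact: (smooth_continuous hR (@test_smooth _ t d setT) Logic.I).
have pc (r : R) : t - d <= r <= t + d -> {for r, continuous (fun r : R => k * (test t d r * g
  r))}.
  move=> /Kd[Ir _]; apply: cvgM; first exact: cvg_cst.
  by apply: cvgM; [exact: tc|exact: gc].
have : 0 < \int[mu]_(r in K) (g t * (k * (test t d r * g r))).
  apply: (@Rintegral_plateau_gt0 _ t d (k * e)) => //; first by rewrite mulr_gt0.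
    by move=> r /pc ?; apply: cvgM => //; exact: cvg_cst.
  move=> r /Kd[Ir er]; rewrite -/(test t d r).
  rewrite mulrAC [leRHS]mulrCA mulrA [leRHS]mulrACA.
  by rewrite ler_wpM2l ?(ltW er) // mulr_ge0 ?(ltW k0) // test_ge0.
have mK : measurable (K : set (measurableTypeR R)) by exact: measurable_itv.
by rewrite (RintegralZl _ mK (integrable_segment pc)) I0 mulr0 ltxx.
Qed.

End Necessity.

Theorem theorem3p7 (R : realType) (E : tvsType R) (frechetE : frechet_space E)
    (N : set E) (openN : open N)
    (L : E * E -> R^o) (smoothL : smooth_map (N `*` setT) setT L)
    (I : set R^o) (openI : open I) (intervalI : is_interval I)
    (c : R^o -> E) (smoothc : smooth_curve I c) (cN : forall t, I t -> N (c t)) :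
  critical N I L c <->
  forall y : E,
    C1_on I (fun t => D2 L (c t) (curve_derive c t) y) /\
    forall t, I t ->
      (fun t => D2 L (c t) (curve_derive c t) y)^`() t =
      D1 L (c t) (curve_derive c t) y.
Proof.
have [hE [p gp] _] := frechetE; have [_ sL] := smoothL.
split=> [crit y|EL].
  split; first exact: (momentum_C1 hE openI sL smoothc cN).
  move=> t It; have mt := is_cderive_momentum hE openI sL smoothc cN (y := y) It.
  have [_ ->] := (is_cderive_derive1 _ _ _).1 mt.
  exact: (EL_of_critical hE gp openN openI sL smoothc cN y crit It).
apply: (critical_of_EL hE gp openN openI intervalI sL smoothc cN) => t It y.
have [[mC _] mF] := EL y; apply/is_cderive_derive1.
by split; [exact: mC|exact: mF].
Qed.
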